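(* Let $G$ be a graph of order $n$ with no isolated vertices, where $n\ge 6$. (i) If $n=6$ and $q(G)\ge q(K_1\vee (K_4\cup K_1))$, then $G$ contains a trebly chorded cycle with three chords incident to a vertex, unless $G\cong K_1\vee (K_4\cup K_1)$. (ii) If $n\ge 7$ and $q(G)\ge q(K_{1,1,n-2}^+)$, then $G$ contains a trebly chorded cycle with three chords incident to a vertex, unless $G\cong K_{1,1,n-2}^+$.
   Context: All graphs are finite and simple. For a graph $G$, $Q(G)=D(G)+A(G)$ is the signless Laplacian matrix, where $A(G)$ is the adjacency matrix and $D(G)$ the diagonal matrix of vertex degrees; $q(G)$ denotes the largest eigenvalue of $Q(G)$ (the signless Laplacian index). A chord of a cycle $C$ is an edge joining two non-consecutive vertices of $C$. ''$G$ contains a trebly chorded cycle with three chords incident to a vertex'' means that $G$ has a cycle $C$ and three distinct edges of $G$, each a chord of $C$, all sharing a common endpoint. $K_m$ is the complete graph on $m$ vertices; $G\cup H$ is the disjoint union and $G\vee H$ the join (disjoint union plus all edges between $V(G)$ and $V(H)$). $K_{1,1,n-2}$ is the complete tripartite graph with parts of sizes $1,1,n-2$, and $K_{1,1,n-2}^+$ is obtained from it by adding one edge inside the part of size $n-2$. *)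

(* Defs.v *)
From HB Require Import structures.
From mathcomp Require Import all_boot all_order all_algebra all_fingroup.
From mathcomp Require Import classical_sets reals.
Set Implicit Arguments. Unset Strict Implicit. Unset Printing Implicit Defensive.
Import Order.TTheory GRing.Theory Num.Theory.
Local Open Scope ring_scope.

Definition simple_graph (n : nat) (e : rel 'I_n) : Prop :=
  symmetric e /\ irreflexive e.

Definition no_isolated (n : nat) (e : rel 'I_n) : Prop :=
  forall v : 'I_n, exists u : 'I_n, e v u.

Definition deg (n : nat) (e : rel 'I_n) (v : 'I_n) : nat := #|[set u | e v u]|.

Definition signless_lap (R : realType) (n : nat) (e : rel 'I_n) : 'M[R]_n :=
  \matrix_(i, j) ((if i == j then (deg e i)%:R else 0) + (e i j)%:R).

Definition q_index (R : realType) (n : nat) (e : rel 'I_n) : R :=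
  sup [set a : R | eigenvalue (signless_lap R e) a].

Definition isomorphic (n : nat) (e1 e2 : rel 'I_n) : Prop :=
  exists s : {perm 'I_n}, forall x y, e1 (s x) (s y) = e2 x y.

(* A chord of the cycle c (a uniq sequence of vertices, consecutive ones and
   last/first adjacent): an edge joining two non-consecutive vertices of c. *)
Definition chord (n : nat) (e : rel 'I_n) (c : seq 'I_n) (x y : 'I_n) : bool :=
  [&& e x y, x \in c, y \in c, y != next c x & x != next c y].

Definition has_trebly_chorded_cycle_at_vertex (n : nat) (e : rel 'I_n) : Prop :=
  exists (c : seq 'I_n) (v a b d : 'I_n),
    [/\ uniq c, (2 < size c)%N, path.cycle e c,
        [/\ chord e c v a, chord e c v b & chord e c v d]
      & uniq [:: a; b; d]].

(* K_1 \/ (K_4 U K_1) on 'I_n (intended n = 6): vertex 0 is the K_1 of the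
   join, vertices 1..4 form K_4, vertex 5 is the isolated K_1 of the union. *)
Definition K1_join_K4_K1 (n : nat) : rel 'I_n :=
  fun i j => (i != j) &&
    [|| (i : nat) == 0%N, (j : nat) == 0%N |
        [&& 1 <= i, i <= 4, 1 <= j & j <= 4]%N].

(* K_{1,1,n-2}^+ on 'I_n: parts {0}, {1}, {2,...,n-1}, plus the edge {2,3}. *)
Definition K11n2_plus (n : nat) : rel 'I_n :=
  fun i j => (i != j) &&
    [|| (i < 2)%N, (j < 2)%N,
        ((i : nat) == 2%N) && ((j : nat) == 3%N) |
        ((i : nat) == 3%N) && ((j : nat) == 2%N)].

(* Main.v *)
(** Taking absolute values in an eigenvector of the signless Laplacian for
    q = q(G) gives y >= 0 with q y_w <= sum of y_w + y_x over the neighbours x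
    of w.  Choose the edge uv maximising y_u + y_v and scale so that
    y_u + y_v = 1; then y_x + y_z <= 1 on every edge xz.  Split the other
    vertices into the common neighbours C of u and v, the private neighbours A
    of u and B of v, and the rest W.  Adding the inequalities at u and v gives
      q - n + |W| + sum_A (y_v - y_x) + sum_B (y_u - y_x) <= 2 sum_C y,
    with nonnegative sums on the left, so all of q's excess over n must be paid
    for by C; in particular |C| >= |W| + 2.  Adding the inequalities over C
    bounds (q - 2) sum_C y by |C| plus the weight of the edges that meet C
    inside G - {u, v}.
    If G has no trebly chorded cycle at a vertex, no path of G - u with ends in
    N(u) meets five neighbours of u, and likewise for v.  Every path through v
    can enter and leave it along C, so there are very few such edges, and the
    two bounds on sum_C y contradict each other unless G is extremal.  The cases
    are |C| >= 4, |C| = 3 and |C| = 2; in the last one all values of y are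
    nearly equal, so that all degrees are large, which is impossible. *)

Require Import Defs.
From HB Require Import structures.
From mathcomp Require Import all_boot all_order all_algebra all_fingroup.
From mathcomp Require Import classical_sets reals.
From mathcomp Require Import ssrAC boolp zify ring lra.
Import Order.TTheory GRing.Theory Num.Theory.
Local Open Scope ring_scope.

Set Implicit Arguments.
Unset Strict Implicit.
Unset Printing Implicit Defensive.

(** * Eigenvalues and subsolutions *)

(** Normalising at an edge instead of at a largest entry makes every summand y_w + y_x at most 1, so
    that the spectral inequalities become counts of edges, and degrees are bounded below by q y_w.
    The extremal graphs enter only through lower bounds on q: an explicit eigenvector is written
    down and its eigenvalue located by the intermediate value theorem. For n >= 7 the bound
    containing 8 / (q - 4) has to be kept exact, because K_{1,1,n-2}^+ attains equality and the
    conclusion needed is that A, B and W are empty. The cases with |C| <= 3 rest on the decimals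
    1.73 and 8.27, which sit just below the true values since several of the final comparisons have
    a margin of about two percent. When C is independent, the obstacle is a single remote vertex
    joined to most of C; every other remote vertex costs more than it contributes. *)

Lemma poly_roots_listable (F : fieldType) (p : {poly F}) :
  p != 0 -> exists s : seq F, forall x, root p x -> x \in s.
Proof.
elim: {p}(size p) {-2}p (leqnn (size p)) => [|k IHk] p.
  by rewrite leqn0 size_poly_eq0 => ->.
move=> szp p0; have [[x px]|nox] := pselect (exists x, root p x); last first.
  by exists [::] => x px; case: nox; exists x.
have [q pE] := factor_theorem p x px.
have q0 : q != 0 by apply: contraNneq p0 => q0; rewrite pE q0 mul0r.
have szq : (size q <= k)%N.
  by move: szp; rewrite pE size_mul ?polyXsubC_eq0 // size_XsubC addn2.
have [s sq] := IHk q szq q0; exists (x :: s) => z.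
by rewrite pE rootM root_XsubC inE => /orP [/sq ->|->]; rewrite ?orbT.
Qed.

Section SignlessIndex.
Context (R : realType) (n : nat).
Implicit Types (e : rel 'I_n) (y : 'I_n -> R).

Lemma eigenvalues_listable e : exists s : seq R,
  forall a, eigenvalue (signless_lap R e) a -> a \in s.
Proof.
have [s sP] := poly_roots_listable (monic_neq0 (char_poly_monic (signless_lap R e))).
by exists s => a; rewrite eigenvalue_root_char; apply: sP.
Qed.

Lemma has_ubound_seq (s : seq R) : exists m, forall a, a \in s -> a <= m.
Proof.
elim: s => [|b s [m mP]]; first by exists 0.
exists (Num.max b m) => a; rewrite inE le_max => /orP [/eqP ->|/mP ->].
  by rewrite lexx.
by rewrite orbT.
Qed.

Lemma le_q_index e a : eigenvalue (signless_lap R e) a -> a <= q_index R e.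
Proof.
move=> ea; apply: ub_le_sup ea.
have [s sP] := eigenvalues_listable e; have [m mP] := has_ubound_seq s.
by exists m => b /= /sP; apply: mP.
Qed.

(** [sup] is 0 on the empty set, so positivity is what produces an eigenvalue at all. The
    eigenvalues lie in a finite list; if all of them were strictly below the supremum, the largest
    one would be a smaller upper bound. *)
Lemma q_index_attained e :
  0 < q_index R e -> eigenvalue (signless_lap R e) (q_index R e).
Proof.
move=> q_gt0; set E := [set a : R | eigenvalue (signless_lap R e) a]%classic.
have hE : has_sup E.
  have [[a ea]|noE] := pselect (exists a, E a); last first.
    move: q_gt0; rewrite /q_index -/E (_ : E = set0) ?sup0 ?ltxx //.
    by rewrite -subset0 => a ea; case: noE; exists a.
  split; first by exists a.
  have [s sP] := eigenvalues_listable e; have [m mP] := has_ubound_seq s.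
  by exists m => b /= /sP; apply: mP.
have [s sP] := eigenvalues_listable e.
have [//|nE] := pselect (E (q_index R e)).
have [m [mq mP]] : exists m, m < q_index R e /\
    forall a, a \in s -> E a -> a <= m.
  have lt_q a : E a -> a < q_index R e.
    move=> ea; rewrite lt_neqAle le_q_index // andbT.
    by apply/eqP => aE; apply: nE; rewrite -aE.
  elim: {sP}s => [|b s [m [mq mP]]].
    by exists (q_index R e - 1); split => //; rewrite ltrBlDr ltrDl.
  have [eb|neb] := pselect (E b); last first.
    exists m; split=> // a; rewrite inE => /orP [/eqP -> /neb //|]; exact: mP.
  exists (Num.max b m); split; first by rewrite gt_max mq lt_q.
  move=> a; rewrite inE le_max => /orP [/eqP -> _|/mP h /h ->].
    by rewrite lexx.
  by rewrite orbT.
suff : q_index R e <= m by rewrite leNgt mq.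
by apply: ge_sup; [case: hE | move=> a ea; apply: mP => //; apply: sP].
Qed.

Definition subsolution e q y :=
  [/\ forall w, 0 <= y w, exists w, 0 < y w &
      forall w, q * y w <= \sum_(x | e w x) (y w + y x)].

Lemma signless_row e (x : 'rV[R]_n) j : symmetric e ->
  (x *m signless_lap R e) 0 j = \sum_(i | e j i) (x 0 j + x 0 i).
Proof.
move=> se; rewrite mxE big_split /= sumr_const.
have -> : #|[pred i | e j i]| = deg e j by rewrite /deg cardsE.
rewrite (eq_bigr (fun i => (if i == j then x 0 i *+ deg e i else 0) +
    (if e j i then x 0 i else 0))); last first.
  move=> i _; rewrite mxE mulrDr; congr (_ + _).
    by case: eqP; rewrite ?mulr0 // mulr_natr.
  by rewrite se; case: (e j i); rewrite ?mulr1 ?mulr0.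
by rewrite big_split /= -!big_mkcond big_pred1_eq.
Qed.

Lemma eigenvalue_subsolution e q : symmetric e -> 0 < q ->
  eigenvalue (signless_lap R e) q -> exists y, subsolution e q y.
Proof.
move=> se q0 /eigenvalueP [x xq /rV0Pn [i xi]].
exists (fun j => `|x 0 j|); split; first by move=> w; apply: normr_ge0.
  by exists i; rewrite normr_gt0.
move=> w; move/matrixP/(_ 0 w): xq; rewrite signless_row // mxE => xq.
rewrite -{1}(gtr0_norm q0) -normrM -xq; apply: le_trans (ler_norm_sum _ _ _) _.
by apply: ler_sum => z _; apply: ler_normD.
Qed.

(** Certifies the explicit eigenvectors of the two extremal graphs; by [le_q_index] any eigenvalue
    found this way is a lower bound for the index. *)
Lemma positive_solution_eigenvalue e q y : symmetric e -> (exists w, y w != 0) ->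
  (forall w, \sum_(x | e w x) (y w + y x) = q * y w) ->
  eigenvalue (signless_lap R e) q.
Proof.
move=> se [w yw] yq; apply/eigenvalueP; exists (\row_j y j).
  apply/rowP => j; rewrite signless_row // !mxE -yq.
  by apply: eq_bigr => i _; rewrite !mxE.
by apply/rV0Pn; exists w; rewrite mxE.
Qed.

End SignlessIndex.

(** * Paths through neighbours of a vertex *)

Section Paths.
Variables (n : nat) (e : rel 'I_n).
Hypotheses (e_sym : symmetric e) (e_irr : irreflexive e).

(** Closing the path through u gives a cycle on which each neighbour of u, other than the two ends
    of the path, is the far end of a chord at u. Five neighbours minus two ends leave three
    chords. *)
Lemma trebly_chorded_of_path u x p :
  uniq [:: u, x & p] -> path e x p -> e u x -> e u (last x p) ->
  (4 < count (e u) (x :: p))%N -> has_trebly_chorded_cycle_at_vertex e.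
Proof.
set s := x :: p => us xp ux ul cnt; set c := u :: s.
have uc : uniq c by [].
have next_u : next c u = x by rewrite next_nth inE eqxx /= eqxx.
have prev_u : prev c u = last x p.
  have /negPf uNs : u \notin s by case/andP: us.
  by rewrite prev_nth /c inE eqxx memNindex ?uNs // -[size s]/(size c).-1 nth_last.
pose t := [seq z <- s | e u z & (z != x) && (z != last x p)].
have szt : (2 < size t)%N.
  (* Discarding x and [last x p] loses at most their multiplicities, and these are at most 1 in a
     duplicate-free list. *)
  have cntE : forall l, (count (e u) l <= count (fun z =>
      e u z && ((z != x) && (z != last x p))) l
      + (count_mem x l + count_mem (last x p) l))%N.
    by elim=> //= z l; case: (e u z); case: eqP => _; case: eqP => _ /=; lia.
  have us' : uniq s by case/andP: us.
  move: (cntE s); rewrite size_filter !count_uniq_mem //.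
  set k := count _ _ in cnt; rewrite -/k; set k' := count _ _.
  by move: cnt; case: (_ \in s); case: (_ \in s) => /=; clearbody k k'; lia.
have ut : uniq t by rewrite filter_uniq //; case/andP: us.
have chord_t z : z \in t -> chord e c u z.
  rewrite mem_filter => /andP [/andP [uz /andP [zx zl]] zs].
  rewrite /chord uz mem_head next_u zx [z \in c]inE zs orbT /=.
  (* If u followed z on the cycle, z would be the predecessor of u, that is, the last vertex of the
     path. *)
  apply: contraNneq zl => /(congr1 (prev c)).
  by rewrite prev_next // prev_u => ->.
case: t szt ut chord_t => [|a [|b [|d t]]] //= _ ut chord_t.
exists c, u, a, b, d; split=> //.
- by move: (leq_trans cnt (count_size _ _)); rewrite /c /s /=; lia.
- by rewrite /c /s /= ux rcons_path xp e_sym.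
- by split; apply: chord_t; rewrite !inE eqxx ?orbT.
by move: ut; rewrite /= !inE !negb_or => /andP [/and3P [-> -> _] /andP [/andP [-> _] _]].
Qed.

Hypothesis e_free : ~ has_trebly_chorded_cycle_at_vertex e.

(* In [no_pathK_i] and [no_path7_ij] the path has K vertices, all of them
   neighbours of u except possibly those in the indicated positions. *)
Lemma no_path5 u x1 x2 x3 x4 x5 :
  uniq [:: u; x1; x2; x3; x4; x5] ->
  e x1 x2 -> e x2 x3 -> e x3 x4 -> e x4 x5 ->
  e u x1 -> e u x2 -> e u x3 -> e u x4 -> e u x5 -> False.
Proof.
move=> us h12 h23 h34 h45 u1 u2 u3 u4 u5; apply: e_free.
apply: (trebly_chorded_of_path us) => //=; first by rewrite h12 h23 h34 h45.
by rewrite u1 u2 u3 u4 u5.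
Qed.

Lemma no_path6_2 u x1 w x2 x3 x4 x5 :
  uniq [:: u; x1; w; x2; x3; x4; x5] ->
  e x1 w -> e w x2 -> e x2 x3 -> e x3 x4 -> e x4 x5 ->
  e u x1 -> e u x2 -> e u x3 -> e u x4 -> e u x5 -> False.
Proof.
move=> us h1w hw2 h23 h34 h45 u1 u2 u3 u4 u5; apply: e_free.
apply: (trebly_chorded_of_path us) => //=; first by rewrite h1w hw2 h23 h34 h45.
by rewrite u1 u2 u3 u4 u5; case: (e u w).
Qed.

Lemma no_path6_3 u x1 x2 w x3 x4 x5 :
  uniq [:: u; x1; x2; w; x3; x4; x5] ->
  e x1 x2 -> e x2 w -> e w x3 -> e x3 x4 -> e x4 x5 ->
  e u x1 -> e u x2 -> e u x3 -> e u x4 -> e u x5 -> False.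
Proof.
move=> us h12 h2w hw3 h34 h45 u1 u2 u3 u4 u5; apply: e_free.
apply: (trebly_chorded_of_path us) => //=; first by rewrite h12 h2w hw3 h34 h45.
by rewrite u1 u2 u3 u4 u5; case: (e u w).
Qed.

Lemma no_path7_24 u x1 w x2 w' x3 x4 x5 :
  uniq [:: u; x1; w; x2; w'; x3; x4; x5] ->
  e x1 w -> e w x2 -> e x2 w' -> e w' x3 -> e x3 x4 -> e x4 x5 ->
  e u x1 -> e u x2 -> e u x3 -> e u x4 -> e u x5 -> False.
Proof.
move=> us h1 h2 h3 h4 h5 h6 u1 u2 u3 u4 u5; apply: e_free.
apply: (trebly_chorded_of_path us) => //=; first by rewrite h1 h2 h3 h4 h5 h6.
by rewrite u1 u2 u3 u4 u5; case: (e u w); case: (e u w').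
Qed.

Lemma no_path7_26 u x1 w x2 x3 x4 w' x5 :
  uniq [:: u; x1; w; x2; x3; x4; w'; x5] ->
  e x1 w -> e w x2 -> e x2 x3 -> e x3 x4 -> e x4 w' -> e w' x5 ->
  e u x1 -> e u x2 -> e u x3 -> e u x4 -> e u x5 -> False.
Proof.
move=> us h1 h2 h3 h4 h5 h6 u1 u2 u3 u4 u5; apply: e_free.
apply: (trebly_chorded_of_path us) => //=; first by rewrite h1 h2 h3 h4 h5 h6.
by rewrite u1 u2 u3 u4 u5; case: (e u w); case: (e u w').
Qed.

End Paths.

(** * Cells of an edge *)

Definition common n (e : rel 'I_n) u v : {set 'I_n} := [set w | e u w && e v w].
Definition private n (e : rel 'I_n) u v : {set 'I_n} :=
  [set w | [&& e u w, ~~ e v w & w != v]].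
Definition remote n (e : rel 'I_n) u v : {set 'I_n} :=
  [set w | [&& ~~ e u w, ~~ e v w, w != u & w != v]].

Section CellMembership.
Variables (n : nat) (e : rel 'I_n) (u v w : 'I_n).

Lemma in_common : (w \in common e u v) = e u w && e v w.
Proof. by rewrite inE. Qed.

Lemma in_private : (w \in private e u v) = [&& e u w, ~~ e v w & w != v].
Proof. by rewrite inE. Qed.

Lemma in_remote :
  (w \in remote e u v) = [&& ~~ e u w, ~~ e v w, w != u & w != v].
Proof. by rewrite inE. Qed.

End CellMembership.

Lemma adjacent_neq n (e : rel 'I_n) x y : irreflexive e -> e x y -> x != y.
Proof. by move=> irr; apply: contraTneq => ->; rewrite irr. Qed.

(* Vertices from different cells differ because u and v see them differently. *)
Ltac unpack_cells :=
  repeat match goal with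
  | H : is_true (in_mem _ ?T) |- _ =>
      match T with context [@common _ _ _ _] =>
      let H1 := fresh "hu" in let H2 := fresh "hv" in
      move: H; rewrite in_common => /andP [H1 H2] end
  | H : is_true (in_mem _ ?T) |- _ =>
      match T with context [@private _ _ _ _] =>
      let H1 := fresh "hu" in let H2 := fresh "hv" in let H3 := fresh "hn" in
      move: H; rewrite in_private => /and3P [H1 /negbTE H2 H3] end
  | H : is_true (in_mem _ ?T) |- _ =>
      match T with context [@remote _ _ _ _] =>
      let H1 := fresh "hu" in let H2 := fresh "hv" in
      let H3 := fresh "hn" in let H4 := fresh "hn" in
      move: H; rewrite in_remote => /and4P [/negbTE H1 /negbTE H2 H3 H4] end
  end.

Lemma separated_neq n (e : rel 'I_n) u x y : e u x -> e u y = false -> x != y.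
Proof. by move=> ux uy; apply: contraTneq ux => ->; rewrite uy. Qed.

Ltac solve_neq irr :=
  match goal with
  | H : is_true (?x != ?y) |- is_true (?x != ?y) => exact H
  | H : is_true (?y != ?x) |- is_true (?x != ?y) => rewrite eq_sym; exact H
  | H : is_true (_ ?x ?y) |- is_true (?x != ?y) => exact (adjacent_neq irr H)
  | H : is_true (_ ?y ?x) |- is_true (?x != ?y) =>
      rewrite eq_sym; exact (adjacent_neq irr H)
  | H : is_true (_ ?u ?x), H' : _ ?u ?y = false |- is_true (?x != ?y) =>
      exact (separated_neq H H')
  | H : is_true (_ ?u ?y), H' : _ ?u ?x = false |- is_true (?x != ?y) =>
      rewrite eq_sym; exact (separated_neq H H')
  end.

Ltac solve_path sym irr :=
  unpack_cells;
  match goal with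
  | |- is_true (uniq _) => rewrite /= !inE !negb_or !andbT;
      repeat (apply/andP; split); solve_neq irr
  | |- _ => first [ assumption | rewrite sym; assumption ]
  end.

Section Cells.
Variables (n : nat) (e : rel 'I_n).
Hypotheses (e_sym : symmetric e) (e_irr : irreflexive e).
Hypothesis e_free : ~ has_trebly_chorded_cycle_at_vertex e.
Variables u v : 'I_n.
Hypothesis e_uv : e u v.

Local Notation C := (common e u v).
Local Notation A := (private e u v).
Local Notation B := (private e v u).
Local Notation W := (remote e u v).

(** From here to [private_across] each proof names a path of G - u carrying five neighbours of u. It
    always passes through v, which joins pieces ending in C or B and is itself one of the five. *)
Lemma two_disjoint_edges c1 c2 c3 c4 : c1 \in C -> c2 \in C -> c3 \in C ->
  c4 \in C -> c1 != c3 -> c1 != c4 -> c2 != c3 -> c2 != c4 ->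
  e c1 c2 -> e c3 c4 -> False.
Proof.
move=> *; apply: (@no_path5 _ _ e_sym e_free u c1 c2 v c3 c4);
solve_path e_sym e_irr.
Qed.

Lemma path3_and_vertex c1 c2 c3 c4 : c1 \in C -> c2 \in C -> c3 \in C ->
  c4 \in C -> c1 != c3 -> c1 != c4 -> c2 != c4 -> c3 != c4 ->
  e c1 c2 -> e c2 c3 -> False.
Proof.
move=> *; apply: (@no_path5 _ _ e_sym e_free u c1 c2 c3 v c4);
solve_path e_sym e_irr.
Qed.

Lemma private_two_common x c1 c2 c3 : x \in A -> c1 \in C -> c2 \in C ->
  c3 \in C -> c1 != c2 -> c1 != c3 -> c2 != c3 -> e x c1 -> e x c2 -> False.
Proof.
move=> *; apply: (@no_path5 _ _ e_sym e_free u c1 x c2 v c3);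
solve_path e_sym e_irr.
Qed.

Lemma private_common_matching x x' c1 c2 : x \in A -> x' \in A -> c1 \in C ->
  c2 \in C -> x != x' -> c1 != c2 -> e x c1 -> e x' c2 -> False.
Proof.
move=> *; apply: (@no_path5 _ _ e_sym e_free u x c1 v c2 x');
solve_path e_sym e_irr.
Qed.

Lemma private_edge_path x c1 c2 c3 : x \in A -> c1 \in C -> c2 \in C ->
  c3 \in C -> c1 != c3 -> c2 != c3 -> e x c1 -> e c1 c2 -> False.
Proof.
move=> *; apply: (@no_path5 _ _ e_sym e_free u x c1 c2 v c3);
solve_path e_sym e_irr.
Qed.

Lemma private_edge_disjoint x c1 c2 c3 : x \in A -> c1 \in C -> c2 \in C ->
  c3 \in C -> c1 != c2 -> c1 != c3 -> e x c1 -> e c2 c3 -> False.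
Proof.
move=> *; apply: (@no_path5 _ _ e_sym e_free u x c1 v c2 c3);
solve_path e_sym e_irr.
Qed.

Lemma disjoint_cherries w w' c1 c2 c3 c4 : w \in W -> w' \in W ->
  c1 \in C -> c2 \in C -> c3 \in C -> c4 \in C -> w != w' ->
  uniq [:: c1; c2; c3; c4] -> e w c1 -> e w c2 -> e w' c3 -> e w' c4 -> False.
Proof.
move=> ? ? ? ? ? ? ?; rewrite /= !inE !negb_or -!andbA.
case/and5P=> ? ? ? ? /and3P [? ? _] *.
apply: (@no_path7_26 _ _ e_sym e_free u c1 w c2 v c3 w' c4);
solve_path e_sym e_irr.
Qed.

Lemma cherry_edge_path w c1 c2 c3 c4 : w \in W -> c1 \in C -> c2 \in C ->
  c3 \in C -> c4 \in C -> uniq [:: c1; c2; c3; c4] ->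
  e w c1 -> e w c2 -> e c2 c3 -> False.
Proof.
move=> ? ? ? ? ?; rewrite /= !inE !negb_or -!andbA.
case/and5P=> ? ? ? ? /and3P [? ? _] *.
apply: (@no_path6_2 _ _ e_sym e_free u c1 w c2 c3 v c4);
solve_path e_sym e_irr.
Qed.

Lemma cherry_edge_disjoint w c1 c2 c3 c4 : w \in W -> c1 \in C -> c2 \in C ->
  c3 \in C -> c4 \in C -> uniq [:: c1; c2; c3; c4] ->
  e w c1 -> e w c2 -> e c3 c4 -> False.
Proof.
move=> ? ? ? ? ?; rewrite /= !inE !negb_or -!andbA.
case/and5P=> ? ? ? ? /and3P [? ? _] *.
apply: (@no_path6_2 _ _ e_sym e_free u c1 w c2 v c3 c4);
solve_path e_sym e_irr.
Qed.

Lemma cherry_private w x c1 c2 c3 : w \in W -> x \in A -> c1 \in C ->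
  c2 \in C -> c3 \in C -> c1 != c2 -> c1 != c3 -> c2 != c3 ->
  e w c1 -> e w c2 -> e x c3 -> False.
Proof.
move=> *; apply: (@no_path6_2 _ _ e_sym e_free u c1 w c2 v c3 x);
solve_path e_sym e_irr.
Qed.

Lemma remote_private_edge w x x' c1 c2 : w \in W -> x \in A -> x' \in A ->
  c1 \in C -> c2 \in C -> c1 != c2 -> e w c1 -> e w x -> e x x' -> False.
Proof.
move=> *; apply: (@no_path6_3 _ _ e_sym e_free u x' x w c1 v c2);
solve_path e_sym e_irr.
Qed.

Lemma remote_private_path w x b x' c1 c2 : w \in W -> x \in A -> b \in B ->
  x' \in A -> c1 \in C -> c2 \in C -> x != x' -> c1 != c2 ->
  e w c1 -> e w x -> e x b -> e b x' -> False.
Proof.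
move=> *; apply: (@no_path7_24 _ _ e_sym e_free u x' b x w c1 v c2);
solve_path e_sym e_irr.
Qed.

Lemma private_common_private x x' c1 c2 : x \in A -> x' \in A -> c1 \in C ->
  c2 \in C -> c1 != c2 -> e x c1 -> e x x' -> False.
Proof.
move=> *; apply: (@no_path5 _ _ e_sym e_free u x' x c1 v c2);
solve_path e_sym e_irr.
Qed.

Lemma private_edge_across x x' b c1 c2 : x \in A -> x' \in A -> b \in B ->
  c1 \in C -> c2 \in C -> x != x' -> e x c1 -> e c1 c2 -> e b x' -> False.
Proof.
move=> *; apply: (@no_path6_2 _ _ e_sym e_free u x' b v c2 c1 x);
solve_path e_sym e_irr.
Qed.

Lemma private_across x x' b c1 c2 : x \in A -> x' \in A -> b \in B ->
  c1 \in C -> c2 \in C -> x != x' -> c1 != c2 -> e x c1 -> e b c2 -> e b x' ->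
  False.
Proof.
move=> *; apply: (@no_path6_2 _ _ e_sym e_free u x' b c2 v c1 x);
solve_path e_sym e_irr.
Qed.

(** The one obstruction centred at a common neighbour: w, c1, u, c3, v is a path, and all five
    vertices are adjacent to c2. *)
Lemma common_path_remote w c1 c2 c3 : w \in W -> c1 \in C -> c2 \in C ->
  c3 \in C -> c1 != c3 -> e c2 c1 -> e c2 c3 -> e w c1 -> e w c2 -> False.
Proof.
move=> *; apply: (@no_path5 _ _ e_sym e_free c2 w c1 u c3 v);
solve_path e_sym e_irr.
Qed.

End Cells.

(** * Inequalities at a heaviest edge *)

Section CellSums.
Variables (n : nat) (e : rel 'I_n).
Hypotheses (e_sym : symmetric e) (e_irr : irreflexive e).
Variables u v : 'I_n.
Hypothesis e_uv : e u v.

Local Notation C := (common e u v).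
Local Notation A := (private e u v).
Local Notation B := (private e v u).
Local Notation W := (remote e u v).

Lemma commonC : common e v u = C.
Proof. by apply/setP => x; rewrite !in_common andbC. Qed.

Lemma remoteC : remote e v u = W.
Proof. by apply/setP => x; rewrite !in_remote andbCA [(x != v) && _]andbC. Qed.

(** A general codomain lets the same partition serve for cardinalities (F constant 1) and for
    weights. *)
Lemma sum_cells (V : nmodType) (F : 'I_n -> V) :
  \sum_x F x = F u + F v + \sum_(x in A) F x + \sum_(x in B) F x +
    \sum_(x in C) F x + \sum_(x in W) F x.
Proof.
have e_vu : e v u by rewrite e_sym.
rewrite (bigID (e u)) /= (bigID (e v)) /= [X in _ + X](bigID (e v)) /=.
rewrite [X in (_ + X) + _](bigD1 v) ?e_uv ?e_irr //=.
rewrite [X in _ + (X + _)](bigD1 u) ?e_irr //=.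
rewrite -(eq_bigl _ _ (in_common e u v)) -[\sum_(i | _ && (i != v)) _]addr0.
have -> : \sum_(i | e u i && ~~ e v i && (i != v)) F i = \sum_(x in A) F x.
  by apply: eq_bigl => x; rewrite in_private andbA.
have -> : \sum_(i | ~~ e u i && e v i && (i != u)) F i = \sum_(x in B) F x.
  by apply: eq_bigl => x; rewrite in_private andbA [e v x && _]andbC.
have -> : \sum_(i | ~~ e u i && ~~ e v i) F i = \sum_(x in W) F x.
  apply: eq_bigl => x; rewrite in_remote andbA; case: (eqVneq x u) => [->|_].
    by rewrite e_vu andbF.
  by case: (eqVneq x v) => [->|_]; rewrite ?e_uv ?andbT.
by rewrite addr0 (AC (1*2*3)%AC (4*2*3*5*1*6)%AC).
Qed.

Lemma card_cells : n = (2 + #|A| + #|B| + #|C| + #|W|)%N.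
Proof.
have := sum_cells (fun=> 1 : int).
rewrite !sumr_const -[1 + 1]/(2%:R) -!natrD => /eqP.
by rewrite eqr_nat card_ord => /eqP.
Qed.

End CellSums.

Section HeavyEdge.
Context (R : realType) (n : nat).
Variables (e : rel 'I_n) (q : R) (y : 'I_n -> R) (u v : 'I_n).
Hypotheses (e_sym : symmetric e) (e_irr : irreflexive e).

Definition heavy_edge (u' v' : 'I_n) := [/\ forall w, 0 <= y w,
  forall w, q * y w <= \sum_(x | e w x) (y w + y x),
  e u' v', y u' + y v' = 1 &
  forall x z, e x z -> y x + y z <= 1].

Lemma heavy_edgeC : heavy_edge u v -> heavy_edge v u.
Proof. by case=> ? ? ? ? ?; split; rewrite // 1?e_sym 1?addrC. Qed.

Hypothesis uv_heavy : heavy_edge u v.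

Local Notation C := (common e u v).
Local Notation A := (private e u v).
Local Notation B := (private e v u).
Local Notation W := (remote e u v).
Local Notation S := (\sum_(x in C) y x).

Let y_ge0 : forall w, 0 <= y w. Proof. by case: uv_heavy. Qed.
Let y_sub : forall w, q * y w <= \sum_(x | e w x) (y w + y x).
Proof. by case: uv_heavy. Qed.
Let e_uv : e u v. Proof. by case: uv_heavy. Qed.
Let y_uv : y u + y v = 1. Proof. by case: uv_heavy. Qed.
Let y_edge : forall x z, e x z -> y x + y z <= 1.
Proof. by case: uv_heavy. Qed.

Lemma heavy_le_deg w : q * y w <= (deg e w)%:R.
Proof.
apply: le_trans (y_sub w) _; rewrite /deg -sum1_card natr_sum.
rewrite [leRHS](eq_bigl (e w)); last by move=> x; rewrite inE.
by apply: ler_sum => x; apply: y_edge.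
Qed.

Lemma heavy_common_le w : w \in C -> y w <= y v /\ y w <= y u.
Proof.
rewrite in_common => /andP [/y_edge h1 /y_edge h2].
by move: h1 h2 y_uv; split; lra.
Qed.

Lemma heavy_common_le_half w : w \in C -> y w <= 2^-1.
Proof. by move=> /heavy_common_le [h1 h2]; move: y_uv; lra. Qed.

(** In the sum of the inequalities at u and v, the vertices u and v contribute 1 each, x in A
    contributes 1 - (y_v - y_x), x in B contributes 1 - (y_u - y_x), x in C contributes 1 + 2 y_x,
    and W nothing. The units add up to n - |W|. *)
Lemma heavy_sum : q - n%:R + #|W|%:R + \sum_(x in A) (y v - y x) +
  \sum_(x in B) (y u - y x) <= 2 * S.
Proof.
have e_vu : e v u by rewrite e_sym.
pose t z x := if e z x then y z + y x else 0.
have : q * y u + q * y v <= \sum_x (t u x + t v x).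
  by rewrite big_split /= -!big_mkcond; apply: lerD.
rewrite (sum_cells e_sym e_irr e_uv) /t !e_irr e_uv e_vu.
rewrite (eq_bigr (fun x => 1 - (y v - y x))); last first.
  by move=> x; rewrite in_private => /and3P [-> /negPf -> _]; move: y_uv; lra.
rewrite [X in _ <= _ + X + _ + _](eq_bigr (fun x => 1 - (y u - y x))); last first.
  by move=> x; rewrite in_private => /and3P [-> /negPf -> _]; move: y_uv; lra.
rewrite [X in _ <= _ + X + _](eq_bigr (fun x => 1 + 2 * y x)); last first.
  by move=> x; rewrite in_common => /andP [-> ->]; move: y_uv; lra.
rewrite [X in _ <= _ + X](eq_bigr (fun=> 0)); last first.
  by move=> x; rewrite in_remote => /and4P [/negPf -> /negPf -> _ _]; lra.
rewrite [X in _ <= _ + X + _ + _ + _]big_split /= !sumr_const.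
rewrite [X in _ <= _ + X + _ + _]big_split /= !sumr_const.
rewrite [X in _ <= _ + X + _]big_split /= !sumr_const -mulr_sumr !sumrN mul0rn.
rewrite -mulrDr y_uv.
have -> : n%:R = 2 + #|A|%:R + #|B|%:R + #|C|%:R + #|W|%:R :> R.
  by rewrite {1}(card_cells e_sym e_irr e_uv) !natrD.
by move: y_uv; lra.
Qed.

Lemma heavy_loss_private x : x \in A -> 0 <= y v - y x.
Proof. by rewrite in_private => /and3P [/y_edge + _ _]; move: y_uv; lra. Qed.

(** The neighbours u and v contribute 2 y_w + 1 together, and 2 y_w moves to the left. *)
Lemma heavy_common_sub w : w \in C ->
  (q - 2) * y w <= 1 + \sum_(x | (x \notin [set u; v]) && e w x) (y w + y x).
Proof.
rewrite in_common => /andP [uw vw]; have := y_sub w.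
rewrite (bigD1 u) 1?e_sym //= (bigD1 v) /=; last first.
  by rewrite e_sym vw eq_sym (adjacent_neq e_irr e_uv).
rewrite (eq_bigl (fun x => (x \notin [set u; v]) && e w x)); last first.
  by move=> x; rewrite !inE negb_or; case: (x == u); case: (x == v); case: (e w x).
by move: y_uv; lra.
Qed.

(** The weight of the edges from x to C. Summed over x in C it counts each edge inside C twice. *)
Definition common_weight x := \sum_(w in C | e w x) (y w + y x).
Local Notation g := common_weight.

(** Exchanging the order of summation charges the weight of an edge at C to its other end. The
    auxiliary h vanishes at u and v, whose edges are already accounted for by |C| and the 2 in q -
    2. *)
Lemma heavy_common_sum : (q - 2) * S <= #|C|%:R + \sum_(x in A) g x +
  \sum_(x in B) g x + \sum_(x in C) g x + \sum_(x in W) g x.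
Proof.
pose h x := if x \in [set u; v] then 0 else g x.
have : (q - 2) * S <= #|C|%:R + \sum_x h x.
  rewrite mulr_sumr; apply: le_trans (ler_sum _ (fun w => @heavy_common_sub w)) _.
  rewrite big_split /= sumr_const lerD2l.
  rewrite (exchange_big_dep (fun x => x \notin [set u; v])) /=; last first.
    by move=> w x _ /andP [].
  rewrite big_mkcond /=; apply: ler_sum => x _; rewrite /h if_neg.
  case: ifP => // xuv; rewrite (eq_bigl (fun w => (w \in C) && e w x)) // => w.
  by rewrite xuv.
rewrite (sum_cells e_sym e_irr e_uv) {1 2}/h !inE !eqxx orbT /=.
rewrite [X in _ <= _ + (_ + X + _ + _ + _)](eq_bigr g); last first.
  move=> x; rewrite in_private => /and3P [ux vx xv]; rewrite /h !inE (negPf xv).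
  by rewrite eq_sym (negPf (adjacent_neq e_irr ux)).
rewrite [X in _ <= _ + (_ + X + _ + _)](eq_bigr g); last first.
  move=> x; rewrite in_private => /and3P [ux vx xv]; rewrite /h !inE (negPf xv).
  by rewrite eq_sym (negPf (adjacent_neq e_irr ux)).
rewrite [X in _ <= _ + (_ + X + _)](eq_bigr g); last first.
  move=> x; rewrite in_common => /andP [ux vx]; rewrite /h !inE.
  rewrite eq_sym (negPf (adjacent_neq e_irr ux)).
  by rewrite eq_sym (negPf (adjacent_neq e_irr vx)).
rewrite [X in _ <= _ + (_ + X)](eq_bigr g); last first.
  move=> x; rewrite in_remote => /and4P [_ _ xu xv].
  by rewrite /h !inE (negPf xu) (negPf xv).
by lra.
Qed.

Lemma common_weight_ge0 x : 0 <= g x.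
Proof. by apply: sumr_ge0 => w _; apply: addr_ge0. Qed.

Lemma common_weight_le_card x : g x <= #|[set w in C | e w x]|%:R.
Proof.
rewrite /g -sum1_card natr_sum.
rewrite [leRHS](eq_bigl (fun w => (w \in C) && e w x)); last first.
  by move=> w; rewrite inE.
by apply: ler_sum => w /andP [_]; apply: y_edge.
Qed.

End HeavyEdge.

Lemma exists_notin (T : finType) (D : {set T}) (s : seq T) :
  (size s < #|D|)%N -> exists2 z, z \in D & z \notin s.
Proof.
move=> sD; apply/subsetPn; apply: contraTN sD => /subset_leq_card Ds.
by rewrite -leqNgt (leq_trans Ds) // card_size.
Qed.

Ltac settle sym :=
  first
    [ assumption | rewrite sym; assumption | rewrite eq_sym; assumption
    | rewrite in_common; first [assumption | apply/andP; split; assumption]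
    | rewrite /= !inE !negb_or !andbT; repeat (apply/andP; split);
      first [assumption | rewrite eq_sym; assumption] ].

(** * How the cells can be attached to the common neighbours *)

Section CommonNeighbours.
Variables (n : nat) (e : rel 'I_n).
Hypotheses (e_sym : symmetric e) (e_irr : irreflexive e).
Hypothesis e_free : ~ has_trebly_chorded_cycle_at_vertex e.

Definition common_nbrs u v x : {set 'I_n} := [set w in common e u v | e w x].
Definition common_indep u v := {in common e u v &, forall w x, ~~ e w x}.

Lemma in_common_nbrs u v x w :
  (w \in common_nbrs u v x) = (w \in common e u v) && e w x.
Proof. by rewrite inE. Qed.

Lemma common_nbrsC u v x : common_nbrs v u x = common_nbrs u v x.
Proof. by rewrite /common_nbrs commonC. Qed.

Lemma private_common_le1 u v x : e u v -> (2 < #|common e u v|)%N ->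
  x \in private e u v -> (#|common_nbrs u v x| <= 1)%N.
Proof.
move=> uv c3 xA; rewrite leqNgt; apply/negP => /card_gt1P [c1 [c2 [h1 h2 c12]]].
move: h1 h2; rewrite !inE => /andP [h1 e1] /andP [h2 e2].
have [z zC] := @exists_notin _ (common e u v) [:: c1; c2] c3.
rewrite !inE negb_or => /andP [z1 z2].
apply: (private_two_common e_sym e_irr e_free uv (x := x) (c1 := c1)
  (c2 := c2) (c3 := z)); settle e_sym.
Qed.

Lemma private_common_indep u v x w : e u v -> (2 < #|common e u v|)%N ->
  x \in private e u v -> w \in common e u v -> e x w -> common_indep u v.
Proof.
move=> uv c3 xA wC xw c1 c2 h1 h2; apply/negP => e12.
have c12 := adjacent_neq e_irr e12.
have [z zC] := @exists_notin _ (common e u v) [:: c1; c2] c3.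
rewrite !inE negb_or => /andP [z1 z2].
have [?|w1] := eqVneq w c1; first subst w.
  apply: (private_edge_path e_sym e_irr e_free uv (x := x) (c1 := c1)
    (c2 := c2) (c3 := z)); settle e_sym.
have [?|w2] := eqVneq w c2; first subst w.
  apply: (private_edge_path e_sym e_irr e_free uv (x := x) (c1 := c2)
    (c2 := c1) (c3 := z)); settle e_sym.
apply: (private_edge_disjoint e_sym e_irr e_free uv (x := x) (c1 := w)
    (c2 := c1) (c3 := c2)); settle e_sym.
Qed.

(** If a second edge shares a vertex with the first, a fourth common neighbour prolongs the
    resulting path through v; if it is disjoint, v joins the two edges. Applied to both orientations
    of c3 c4, the conclusion identifies the edge. *)
Lemma common_edge_unique u v c1 c2 c3 c4 : e u v -> (3 < #|common e u v|)%N ->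
  c1 \in common e u v -> c2 \in common e u v -> c3 \in common e u v ->
  c4 \in common e u v -> e c1 c2 -> e c3 c4 -> (c3 == c1) || (c3 == c2).
Proof.
move=> uv cC h1 h2 h3 h4 e12 e34; apply/negPn/negP; rewrite negb_or.
case/andP=> n31 n32.
have [?|n41] := eqVneq c4 c1; first subst c4.
  have [z zC] := @exists_notin _ (common e u v) [:: c1; c2; c3] cC.
  rewrite !inE !negb_or => /and3P [z1 z2 z3].
  apply: (path3_and_vertex e_sym e_irr e_free uv (c1 := c3) (c2 := c1)
    (c3 := c2) (c4 := z)); settle e_sym.
have [?|n42] := eqVneq c4 c2; first subst c4.
  have [z zC] := @exists_notin _ (common e u v) [:: c1; c2; c3] cC.
  rewrite !inE !negb_or => /and3P [z1 z2 z3].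
  apply: (path3_and_vertex e_sym e_irr e_free uv (c1 := c3) (c2 := c2)
    (c3 := c1) (c4 := z)); settle e_sym.
apply: (two_disjoint_edges e_sym e_irr e_free uv (c1 := c1) (c2 := c2)
    (c3 := c3) (c4 := c4)); settle e_sym.
Qed.

(** Among three neighbours of w in C one, z, avoids c1 and c2. With a second neighbour t the cherry
    z, w, t continues along the edge c1 c2 if t lies on it, and otherwise reaches that edge through
    v. *)
Lemma remote_common_le2 u v c1 c2 w : e u v -> (3 < #|common e u v|)%N ->
  c1 \in common e u v -> c2 \in common e u v -> e c1 c2 ->
  w \in remote e u v -> (#|common_nbrs u v w| <= 2)%N.
Proof.
move=> uv cC h1 h2 e12 wW; rewrite leqNgt; apply/negP => gt2.
have c12 := adjacent_neq e_irr e12.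
have [z] := @exists_notin _ (common_nbrs u v w) [:: c1; c2] gt2.
rewrite !inE !negb_or => /andP [/andP [uz vz] ez] /andP [z1 z2].
have zC : z \in common e u v by rewrite inE uz.
have [t] := @exists_notin _ (common_nbrs u v w) [:: z] (ltnW gt2).
rewrite !inE => /andP [/andP [ut vt] et] tz.
have tC : t \in common e u v by rewrite inE ut.
have [s sC] := @exists_notin _ (common e u v) [:: c1; c2; z] cC.
rewrite !inE !negb_or => /and3P [s1 s2 s3].
have [?|t1] := eqVneq t c1; first subst t.
  apply: (cherry_edge_path e_sym e_irr e_free uv (w := w) (c1 := z) (c2 := c1)
     (c3 := c2) (c4 := s)); settle e_sym.
have [?|t2] := eqVneq t c2; first subst t.
  apply: (cherry_edge_path e_sym e_irr e_free uv (w := w) (c1 := z) (c2 := c2)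
     (c3 := c1) (c4 := s)); settle e_sym.
apply: (cherry_edge_disjoint e_sym e_irr e_free uv (w := w) (c1 := z) (c2 := t)
     (c3 := c1) (c4 := c2)); settle e_sym.
Qed.

(** Four neighbours of w leave two that avoid any two neighbours of w', and the two disjoint
    cherries are joined through v. *)
Lemma remote_common_le1 u v w w' : e u v -> w \in remote e u v ->
  w' \in remote e u v -> w' != w -> (3 < #|common_nbrs u v w|)%N ->
  (#|common_nbrs u v w'| <= 1)%N.
Proof.
move=> uv wW w'W ww' gt3; rewrite leqNgt; apply/negP => /card_gt1P.
case=> [c1 [c2 [h1 h2 c12]]].
have [z zN] := @exists_notin _ (common_nbrs u v w) [:: c1; c2] (ltnW gt3).
have [t tN] := @exists_notin _ (common_nbrs u v w) [:: c1; c2; z] gt3.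
move: h1 h2 zN tN; rewrite !inE !negb_or.
move=> /andP [/andP [u1 v1] e1] /andP [/andP [u2 v2] e2].
move=> /andP [/andP [uz vz] ez] /andP [/andP [ut vt] et].
move=> /and3P [t1 t2 tz] /andP [z1 z2].
apply: (disjoint_cherries e_sym e_irr e_free uv (w := w') (w' := w) (c1 := c1)
  (c2 := c2) (c3 := z) (c4 := t)); settle e_sym.
Qed.

Lemma remote_private_common0 u v w x : e u v -> w \in remote e u v ->
  (2 < #|common_nbrs u v w|)%N -> x \in private e u v ->
  #|common_nbrs u v x| = 0%N.
Proof.
move=> uv wW gt2 xA; apply/eqP; rewrite cards_eq0; apply/eqP/setP => c.
rewrite [RHS]inE; apply/negP; rewrite !inE => /andP [/andP [uc vc] ec].
have [z zN] := @exists_notin _ (common_nbrs u v w) [:: c] (ltnW gt2).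
have [t tN] := @exists_notin _ (common_nbrs u v w) [:: c; z] gt2.
move: zN tN; rewrite !inE !negb_or.
move=> /andP [/andP [uz vz] ez] /andP [/andP [ut vt] et] /andP [tc tz] zc.
apply: (cherry_private e_sym e_irr e_free uv (w := w) (x := x) (c1 := z)
  (c2 := t) (c3 := c)); settle e_sym.
Qed.

End CommonNeighbours.

Section RemoteDegrees.
Variables (n : nat) (e : rel 'I_n).
Hypotheses (e_sym : symmetric e) (e_irr : irreflexive e).
Hypothesis e_free : ~ has_trebly_chorded_cycle_at_vertex e.
Variables (u v w : 'I_n).
Hypothesis e_uv : e u v.

Local Notation A := (private e u v).
Local Notation B := (private e v u).

(** A vertex of A adjacent to w has no neighbour in C and none in A, so it sees only u, w and part
    of B. By [remote_private_path] a vertex of B sees at most one such vertex, so double counting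
    bounds the edges to B by |B|. *)
Lemma remote_private_deg : remote e u v = [set w] ->
  (2 < #|common_nbrs e u v w|)%N ->
  (\sum_(x in [set x in A | e w x]) deg e x <=
     2 * #|[set x in A | e w x]| + #|B|)%N.
Proof.
move=> W1 gt2; have wW : w \in remote e u v by rewrite W1 inE.
have [c1 [c2 [h1 h2 c12]]] := card_gt1P (ltnW gt2).
move: h1 h2; rewrite !inE => /andP [h1 ec1] /andP [h2 ec2].
set Aw := [set x in A | e w x].
have degx x : x \in Aw -> (deg e x <= 2 + #|[set b in B | e x b]|)%N.
  rewrite inE => /andP [xA wx]; rewrite /deg.
  have xv : ~~ e x v by move: xA; rewrite e_sym in_private => /and3P [].
  have sub : [set z | e x z] \subset [set u; w] :|: [set b in B | e x b].
    apply/fintype.subsetP => z; rewrite !inE => xz; rewrite xz andbT.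
    have [//|zu] := eqVneq z u; have [//|zw] := eqVneq z w; rewrite andbT /=.
    have zv : z != v by apply: contraTneq xz => ->.
    have uz : ~~ e u z.
      apply/negP => uz; have [vz|vz] := boolP (e v z).
        have /eqP := remote_private_common0 e_sym e_irr e_free e_uv wW gt2 xA.
        by rewrite cards_eq0 => /eqP/setP/(_ z); rewrite !inE uz vz [e z x]e_sym xz.
      have zA : z \in A by rewrite in_private uz vz zv.
      apply: (remote_private_edge e_sym e_irr e_free e_uv (w := w) (x := x)
        (x' := z) (c1 := c1) (c2 := c2)); settle e_sym.
    rewrite uz andbT; apply/negPn/negP => vz.
    have : z \in remote e u v by rewrite in_remote uz vz zu zv.
    by rewrite W1 inE (negPf zw).
  apply: leq_trans (subset_leq_card sub) _; rewrite cardsU.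
  by apply: leq_trans (leq_subr _ _) _; rewrite leq_add2r cards2; case: (_ != _).
apply: leq_trans (_ : \sum_(x in Aw) (2 + #|[set b in B | e x b]|) <= _)%N.
  by apply: leq_sum => x; apply: degx.
rewrite big_split /= sum_nat_const mulnC leq_add2l.
under eq_bigr => x _ do rewrite -sum1dep_card.
rewrite (exchange_big_dep (mem B)) /=; last by move=> x b _ /andP [].
rewrite -sum1_card; apply: leq_sum => b bB.
rewrite sum1dep_card leqNgt; apply/negP => /card_gt1P [x [x' [h3 h4 xx']]].
move: h3 h4; rewrite [x \in _]inE [x' \in _]inE ![_ \in Aw]inE => /andP [].
move=> /andP [xA wx] /andP [_ xb] /andP [/andP [x'A wx'] /andP [_ x'b]].
apply: (remote_private_path e_sym e_irr e_free e_uv (w := w) (x := x) (b := b)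
  (x' := x') (c1 := c1) (c2 := c2)); settle e_sym.
Qed.

End RemoteDegrees.

(* Writing r for the index of K_{1,1,n-2}^+, its characteristic equation is
   (r - n) (r - 2) = 2 (n - 2) + 8 / (r - 4), and r - n >= 1.73 with near equality
   at n = 7 and n = 8.  At n = 6 the index of K_1 \/ (K_4 U K_1) exceeds 8.27. *)
Definition large_index (R : realType) n (q : R) :=
  [/\ 827 / 100 <= q, n%:R + 173 / 100 <= q &
  2 * (n%:R - 2) + 8 / (q - 4) <= (q - n%:R) * (q - 2)].

Lemma large_index_gap (R : realType) n (q : R) : large_index n q ->
  2 * (n%:R - 2) < (q - n%:R) * (q - 2).
Proof.
case=> q8 _; apply: lt_le_trans; rewrite ltrDl divr_gt0 //.
by move: q8; lra.
Qed.

(** * Consequences of a large index at a heavy edge *)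

Section LargeIndex.
Context (R : realType) (n : nat).
Variables (e : rel 'I_n) (q : R) (y : 'I_n -> R) (u v : 'I_n).
Hypotheses (e_sym : symmetric e) (e_irr : irreflexive e).
Hypothesis e_free : ~ has_trebly_chorded_cycle_at_vertex e.
Hypothesis q_large : large_index n q.
Hypothesis uv_heavy : heavy_edge e q y u v.

Local Notation C := (common e u v).
Local Notation A := (private e u v).
Local Notation B := (private e v u).
Local Notation W := (remote e u v).
Local Notation S := (\sum_(x in C) y x).
Local Notation g := (common_weight e y u v).

Let q8 : 827 / 100 <= q. Proof. by case: q_large. Qed.
Let qn : n%:R + 173 / 100 <= q. Proof. by case: q_large. Qed.
Let qK : 2 * (n%:R - 2) < (q - n%:R) * (q - 2).
Proof. exact: large_index_gap. Qed.
Let e_uv : e u v. Proof. by case: uv_heavy. Qed.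
Let e_vu : e v u. Proof. by rewrite e_sym. Qed.
Let vu_heavy := heavy_edgeC e_sym uv_heavy.

Lemma cells_natr : n%:R = 2 + #|A|%:R + #|B|%:R + #|C|%:R + #|W|%:R :> R.
Proof. by rewrite {1}(card_cells e_sym e_irr e_uv) !natrD. Qed.

Lemma heavy_sum_le : q - n%:R + #|W|%:R <= 2 * S.
Proof.
apply: le_trans (heavy_sum e_sym e_irr uv_heavy).
have hA : 0 <= \sum_(x in A) (y v - y x).
  by apply: sumr_ge0 => x; apply: (heavy_loss_private uv_heavy).
have hB : 0 <= \sum_(x in B) (y u - y x).
  by apply: sumr_ge0 => x; apply: (heavy_loss_private vu_heavy).
by lra.
Qed.

Lemma common_sum_le_half : 2 * S <= #|C|%:R.
Proof.
rewrite mulr_sumr -sum1_card natr_sum; apply: ler_sum => w wC.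
by have := heavy_common_le_half uv_heavy wC; lra.
Qed.

(** As 2 y_c <= 1 on C, [heavy_sum_le] gives |C| >= |W| + 1.73, and integrality rounds this up. *)
Lemma common_large : (#|W| + 2 <= #|C|)%N.
Proof.
rewrite addn2 ltnNge; apply/negP; rewrite -(ler_nat R) -natr1.
by move: heavy_sum_le common_sum_le_half qn; lra.
Qed.

Lemma sum_weight_le (D : {set 'I_n}) k :
  (forall x, x \in D -> #|common_nbrs e u v x| <= k)%N ->
  \sum_(x in D) g x <= (k * #|D|)%:R.
Proof.
move=> Dk; rewrite mulnC -sum_nat_const natr_sum; apply: ler_sum => x /Dk xk.
by apply: le_trans (common_weight_le_card uv_heavy x) _; rewrite ler_nat.
Qed.

Lemma sum_weight_private : (2 < #|C|)%N -> \sum_(x in A) g x <= #|A|%:R.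
Proof.
move=> c3; rewrite -[#|A|]mul1n; apply: sum_weight_le => x.
exact: private_common_le1.
Qed.

Lemma sum_weight_private' : (2 < #|C|)%N -> \sum_(x in B) g x <= #|B|%:R.
Proof.
move=> c3; rewrite -[#|B|]mul1n; apply: sum_weight_le => x xB.
by rewrite -common_nbrsC private_common_le1 // commonC.
Qed.

Lemma sum_weight_indep : common_indep e u v -> \sum_(x in C) g x = 0.
Proof.
move=> indep; apply: big1 => x xC; apply: big1 => w /andP [wC].
by rewrite (negPf (indep _ _ wC xC)).
Qed.

(** The edge count gives (q - 2) S <= |C| + |A| + |B| + 3 |W| = n - 2 + 2 |W|. Doubling and
    comparing with (q - n + |W|)(q - 2) contradicts [large_index_gap], since q - 2 >= 4 absorbs the
    terms in |W|. *)
Lemma indep_contra : (2 < #|C|)%N -> common_indep e u v ->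
  (forall w, w \in W -> #|common_nbrs e u v w| <= 3)%N -> False.
Proof.
move=> c3 indep W3; have := heavy_common_sum e_sym e_irr uv_heavy.
rewrite sum_weight_indep //.
move: (sum_weight_private c3) (sum_weight_private' c3) (sum_weight_le W3).
move: heavy_sum_le cells_natr (ler0n R #|W|) q8 qK; rewrite natrM.
move: (\sum_(x in A) _) (\sum_(x in B) _) (\sum_(x in C) _) (\sum_(x in W) _).
move: #|A|%:R #|B|%:R #|C|%:R #|W|%:R n%:R => a b c r N.
move=> gA gB s gW hs hN r0 hq hK h1 h2 h3 h4.
have : (q - N + r) * (q - 2) <= 2 * s * (q - 2) by rewrite ler_wpM2r //; lra.
have : 0 <= r * (q - 8) by rewrite mulr_ge0 //; lra.
by nra.
Qed.

(** The contrapositive of [private_common_indep], used from both ends of the edge u v. *)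
Lemma common_edge_private0 x c1 c2 : (2 < #|C|)%N -> c1 \in C -> c2 \in C ->
  e c1 c2 -> x \in A :|: B -> #|common_nbrs e u v x| = 0%N.
Proof.
move=> c3 h1 h2 e12 xAB; apply/eqP; rewrite cards_eq0.
apply/eqP/setP => w; rewrite [RHS]inE; apply/negP; rewrite in_common_nbrs.
case/andP=> wC; rewrite e_sym => xw.
have : common_indep e u v.
  move: xAB; rewrite finset.in_setU => /orP [xA|xB].
    exact: (private_common_indep e_sym e_irr e_free e_uv c3 xA wC xw).
  rewrite -commonC in c3 wC.
  have := private_common_indep e_sym e_irr e_free e_vu c3 xB wC xw.
  by rewrite /common_indep commonC.
by move=> /(_ _ _ h1 h2); rewrite e12.
Qed.

Lemma common_edge_sum_private0 c1 c2 : (2 < #|C|)%N -> c1 \in C -> c2 \in C ->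
  e c1 c2 -> \sum_(x in A) g x = 0 /\ \sum_(x in B) g x = 0.
Proof.
move=> c3 h1 h2 e12; split; apply/eqP; rewrite eq_le sumr_ge0 ?andbT;
  try by move=> x _; apply: (common_weight_ge0 uv_heavy).
- rewrite -[0]/(0 * #|A|)%:R; apply: (@sum_weight_le _ 0%N) => x xA.
  by rewrite (common_edge_private0 c3 h1 h2 e12) // finset.in_setU xA.
rewrite -[0]/(0 * #|B|)%:R; apply: (@sum_weight_le _ 0%N) => x xB.
by rewrite (common_edge_private0 c3 h1 h2 e12) // finset.in_setU xB orbT.
Qed.

Lemma heavy_common_sub_cells w : w \in C ->
  (q - 2) * y w <= 1 + \sum_(x in A | e w x) (y w + y x)
    + \sum_(x in B | e w x) (y w + y x) + \sum_(x in C | e w x) (y w + y x)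
    + \sum_(x in W | e w x) (y w + y x).
Proof.
move=> wC; apply: le_trans (heavy_common_sub e_sym e_irr uv_heavy wC) _.
have uvC z : z \in A :|: B :|: C :|: W -> z \notin [set u; v].
  rewrite !finset.in_setU => zD; rewrite !inE; apply/negP => /orP [] /eqP E;
  by move: zD; rewrite E !in_private in_common in_remote !e_irr ?eqxx ?e_uv ?e_vu
    ?andbF.
have cellE (D : {set 'I_n}) : D \subset A :|: B :|: C :|: W ->
    \sum_(x in D) (if (x \notin [set u; v]) && e w x then y w + y x else 0)
    = \sum_(x in D | e w x) (y w + y x).
  move/fintype.subsetP => sD; rewrite -big_mkcondr; apply: eq_bigl => x.
  by case xD: (x \in D); rewrite // uvC ?sD.
rewrite big_mkcond /= (sum_cells e_sym e_irr e_uv) !inE !eqxx orbT /=.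
rewrite !cellE; first by lra.
all: by apply/fintype.subsetP => x; rewrite !finset.in_setU => ->; rewrite ?orbT.
Qed.

Section SingleEdge.
Variables c1 c2 : 'I_n.
Hypotheses (c4 : (3 < #|C|)%N) (c1C : c1 \in C) (c2C : c2 \in C).
Hypothesis e12 : e c1 c2.

Let c12 : c1 != c2. Proof. exact: (adjacent_neq e_irr e12). Qed.

Lemma common_edgeE z t : z \in C -> t \in C ->
  e z t = (z == c1) && (t == c2) || (z == c2) && (t == c1).
Proof.
move=> zC tC; apply/idP/idP; last first.
  by case/orP=> /andP [/eqP -> /eqP ->]; rewrite // e_sym.
move=> ezt; have ezt' : e t z by rewrite e_sym.
have zt := adjacent_neq e_irr ezt.
have hz := common_edge_unique e_sym e_irr e_free e_uv c4 c1C c2C zC tC e12 ezt.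
have ht := common_edge_unique e_sym e_irr e_free e_uv c4 c1C c2C tC zC e12 ezt'.
by case/orP: hz => /eqP zE; case/orP: ht => /eqP tE; move: zt;
  rewrite zE tE ?eqxx ?orbT.
Qed.

Lemma sum_weight_edge : \sum_(x in C) g x = 2 * (y c1 + y c2).
Proof.
have gE x : x \in C -> g x = if x == c1 then y c1 + y c2 else
    if x == c2 then y c1 + y c2 else 0.
  move=> xC; rewrite /common_weight.
  have [->|x1] := eqVneq x c1.
    rewrite (big_pred1 c2) 1?addrC // => w /=.
    case wC: (w \in C); last by apply/esym; apply: contraFF wC => /eqP ->.
    by rewrite common_edgeE // (negPf c12) eqxx andbF andbT.
  have [->|x2] := eqVneq x c2.
    rewrite (big_pred1 c1) // => w /=.
    case wC: (w \in C); last by apply/esym; apply: contraFF wC => /eqP ->.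
    by rewrite common_edgeE // eqxx [c2 == c1]eq_sym (negPf c12) andbF andbT orbF.
  apply: big1 => w /andP [wC]; rewrite common_edgeE //.
  by rewrite (negPf x1) (negPf x2) !andbF.
rewrite (eq_bigr _ gE) (bigD1 c1) //= eqxx (bigD1 c2) /=; last by rewrite c2C eq_sym.
rewrite [c2 == c1]eq_sym (negPf c12) eqxx big1 ?addr0; first by lra.
by move=> x /andP [/andP [_ /negPf ->] /negPf ->].
Qed.

(** The sum of the inequalities at c1 and c2: apart from u and v, these see only each other and W.
    For empty W this makes 4 (y_c1 + y_c2) at most 8 / (q - 4), the term kept in [large_index]. *)
Lemma sum_edge_le : (q - 4) * (y c1 + y c2) <= 2 + 2 * #|W|%:R.
Proof.
have priv0 z x : z \in C -> x \in A :|: B -> e z x = false.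
  move=> zC xAB; have := common_edge_private0 (ltnW c4) c1C c2C e12 xAB.
  by move=> /eqP; rewrite cards_eq0 => /eqP/setP/(_ z);
    rewrite in_common_nbrs zC inE.
have bound z t : z \in C -> t \in C -> (z == c1) && (t == c2) ||
    (z == c2) && (t == c1) -> (q - 2) * y z <= 1 + (y z + y t) + #|W|%:R.
  move=> zC tC zt; apply: le_trans (heavy_common_sub_cells zC) _.
  rewrite [X in _ + X + _ + _ + _]big_pred0; last first.
    by move=> x; apply/negP => /andP [xA]; rewrite priv0 // finset.in_setU xA.
  rewrite [X in _ + X + _ + _]big_pred0; last first.
    by move=> x; apply/negP => /andP [xA]; rewrite priv0 // finset.in_setU xA orbT.
  rewrite !addr0 (big_pred1 t); last first.
    move=> x /=; case xC: (x \in C); last first.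
      by apply/esym; apply: contraFF xC => /eqP ->.
    rewrite common_edgeE //; case/orP: zt => /andP [/eqP -> /eqP ->].
      by rewrite eqxx (negPf c12) orbF.
    by rewrite eqxx [c2 == c1]eq_sym (negPf c12).
  rewrite lerD2l big_mkcondr -sum1_card natr_sum; apply: ler_sum => x _ /=.
  by case: ifP => // zx; case: uv_heavy => _ _ _ _; apply.
have h1 := bound c1 c2 c1C c2C; rewrite !eqxx /= in h1.
have h2 := bound c2 c1 c2C c1C; rewrite !eqxx orbT /= in h2.
by move: (h1 isT) (h2 isT); lra.
Qed.

(** All estimates are equalities for K_{1,1,n-2}^+, so the terms 8 / (q - 4) cancel exactly. What
    remains is 2 (|A| + |B| + |W|) <= |W| (8 - q), whose right side is at most 0. *)
Lemma single_edge_cells : [/\ #|A| = 0, #|B| = 0 & #|W| = 0]%N.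
Proof.
have W2 w : w \in W -> (#|common_nbrs e u v w| <= 2)%N.
  exact: (remote_common_le2 e_sym e_irr e_free e_uv c4 c1C c2C e12).
have [sA sB] := common_edge_sum_private0 (ltnW c4) c1C c2C e12.
have := heavy_common_sum e_sym e_irr uv_heavy.
rewrite sum_weight_edge sA sB => hS.
have : #|A|%:R + #|B|%:R + #|W|%:R <= 0 :> R; last first.
  rewrite -!natrD lern0 !addn_eq0 -andbA => /and3P [/eqP -> /eqP -> /eqP ->].
  by [].
(* h stands for 8 / (q - 4); as q >= 8 it is at most 2, so that h |W| can be absorbed by |W| (q -
   2). *)
have [h [h0 h2 h4 hK]] : exists h : R, [/\ 0 <= h, h <= 2, h * (q - 4) = 8 &
    2 * (n%:R - 2) + h <= (q - n%:R) * (q - 2)].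
  have q4 : 0 < q - 4 by move: q8; lra.
  exists (8 / (q - 4)); case: q_large => _ _ ->; split; rewrite ?divfK ?gt_eqF //.
    by rewrite divr_ge0 // ltW.
  by rewrite ler_pdivrMr //; move: q8; lra.
move: hS; move: sum_edge_le (sum_weight_le W2) heavy_sum_le cells_natr.
move: (ler0n R #|W|) (ler0n R #|A|) (ler0n R #|B|) q8; rewrite natrM.
move: (y c1 + y c2) (\sum_(x in C) _) (\sum_(x in W) _) hK.
move: #|A|%:R #|B|%:R #|C|%:R #|W|%:R n%:R => a b c r N.
move=> Y s gW hK r0 a0 b0 hq hY hgW hs hN hS.
have h5 : (q - N + r) * (q - 2) <= 2 * s * (q - 2) by rewrite ler_wpM2r //; lra.
have h6 : Y <= h * (1 + r) / 4.
  by rewrite -(ler_pM2l (_ : 0 < q - 4)); [nra | lra].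
have h7 : h * r <= 2 * r by rewrite ler_wpM2r.
have h8 : 0 <= r * (q - 8) by rewrite mulr_ge0 //; lra.
by nra.
Qed.

End SingleEdge.

End LargeIndex.

(** * Four common neighbours *)

Section RemoteHub.
Context (R : realType) (n : nat).
Variables (e : rel 'I_n) (q : R) (y : 'I_n -> R) (u v : 'I_n).
Hypotheses (e_sym : symmetric e) (e_irr : irreflexive e).
Hypothesis e_free : ~ has_trebly_chorded_cycle_at_vertex e.
Hypothesis q_large : large_index n q.
Hypothesis uv_heavy : heavy_edge e q y u v.

Local Notation C := (common e u v).
Local Notation A := (private e u v).
Local Notation B := (private e v u).
Local Notation W := (remote e u v).
Local Notation S := (\sum_(x in C) y x).
Local Notation g := (common_weight e y u v).

Let q8 : 827 / 100 <= q. Proof. by case: q_large. Qed.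
Let qn : n%:R + 173 / 100 <= q. Proof. by case: q_large. Qed.
Let qK : 2 * (n%:R - 2) < (q - n%:R) * (q - 2).
Proof. exact: large_index_gap. Qed.
Let e_uv : e u v. Proof. by case: uv_heavy. Qed.
Let e_vu : e v u. Proof. by rewrite e_sym. Qed.
Let y_ge0 w : 0 <= y w. Proof. by case: uv_heavy. Qed.

Section Hub.
Variable w : 'I_n.
Hypotheses (indep : common_indep e u v) (wW : w \in W).
Hypothesis w4 : (3 < #|common_nbrs e u v w|)%N.

Lemma hub_le1 : y w <= 1.
Proof.
have /card_gt0P [z] : (0 < #|common_nbrs e u v w|)%N by apply: leq_trans w4.
rewrite in_common_nbrs => /andP [_ zw]; have [_ _ _ _ /(_ _ _ zw)] := uv_heavy.
by move: (y_ge0 z); lra.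
Qed.

Lemma hub_private_weight0 : \sum_(x in A) g x = 0 /\ \sum_(x in B) g x = 0.
Proof.
split; apply/eqP; rewrite eq_le sumr_ge0 ?andbT;
  try by move=> x _; apply: (common_weight_ge0 uv_heavy).
  rewrite -[0]/(0 * #|A|)%:R; apply: (sum_weight_le uv_heavy (k := 0%N)) => x xA.
  by rewrite (remote_private_common0 e_sym e_irr e_free e_uv wW (ltnW w4) xA).
rewrite -[0]/(0 * #|B|)%:R; apply: (sum_weight_le uv_heavy (k := 0%N)) => x xB.
have wW' : w \in remote e v u by rewrite remoteC.
have w4' : (3 < #|common_nbrs e v u w|)%N by rewrite common_nbrsC.
have := remote_private_common0 e_sym e_irr e_free e_vu wW' (ltnW w4') xB.
by rewrite common_nbrsC => ->.
Qed.

(** The hub w contributes at most S + |C| y_w, which turns q - 2 into q - 3; every other remote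
    vertex has at most one neighbour in C and contributes at most 1. *)
Lemma hub_common_sum :
  (q - 3) * S <= #|C|%:R * (1 + y w) + (#|W|%:R - 1).
Proof.
have := heavy_common_sum e_sym e_irr uv_heavy.
have [-> ->] := hub_private_weight0; rewrite (sum_weight_indep _ indep) [\sum_(x in W) _](bigD1 w) //=.
have gw : g w <= S + #|C|%:R * y w.
  apply: le_trans (_ : \sum_(z in C) (y z + y w) <= _).
    rewrite /common_weight big_mkcondr /=; apply: ler_sum => z _.
    by case: ifP => // _; rewrite addr_ge0.
  by rewrite big_split /= sumr_const mulr_natl.
have rest : \sum_(x in W | x != w) g x <= #|W|%:R - 1.
  rewrite lerBrDl -sum1_card natr_sum [leRHS](bigD1 w) //= lerD2l.
  apply: ler_sum => x /andP [xW xw].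
  apply: le_trans (common_weight_le_card uv_heavy x) _; rewrite ler_nat.
  exact: (remote_common_le1 e_sym e_irr e_free e_uv wW xW xw w4).
by move: rest gw; lra.
Qed.

(* The graph obtained from K_{3,n-3} by an edge in the small side is the model: w
   plays the third vertex of that side, and y_w <= 1/2 already contradicts
   [heavy_sum_le].  A larger y_w is only possible when A and B are small, and then
   the inequality at w itself gives y_w <= 0.47. *)
Lemma hub_contra : False.
Proof.
have hS := hub_common_sum; have hle1 := hub_le1.
have hsum := heavy_sum_le e_sym e_irr uv_heavy.
have hN := cells_natr e_sym e_irr uv_heavy.
have W1 : (0 < #|W|)%N by apply/card_gt0P; exists w.
have q3 : (q - n%:R + #|W|%:R) * (q - 3) <= 2 * (#|C|%:R * (1 + y w) + (#|W|%:R - 1)).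
  rewrite (le_trans (_ : _ <= 2 * S * (q - 3))) //; last by move: hS; nra.
  by rewrite ler_wpM2r //; move: q8; lra.
(* A second remote vertex enlarges the left side of [q3] so much that y_w <= 1 suffices. *)
have [W2|] := leqP 2 #|W|.
  move: W2 q3 hN hle1 (y_ge0 w) (ler0n R #|A|) (ler0n R #|B|) (ler0n R #|C|) q8 qn qK.
  rewrite -(ler_nat R); move: #|A|%:R #|B|%:R #|C|%:R #|W|%:R n%:R (y w).
  move=> a b c r N x r2 h hN x1 x0 a0 b0 c0 h8 hn hK.
  have h1 : c * x <= c by rewrite ler_piMr.
  have h2 : 0 <= (r - 2) * (q - 8) by rewrite mulr_ge0 //; lra.
  by nra.
move=> W2; have {W1 W2}W1 : #|W| = 1%N by apply/eqP; rewrite eqn_leq W1 -ltnS W2.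
have /cards1P [w' W1'] : #|W| == 1%N by rewrite W1.
have ww' : w' = w by move: wW; rewrite W1' inE => /eqP.
subst w'; pose Aw := [set z in A | e w z]; pose Bw := [set z in B | e w z].
(* The inequality at w, in which all of C is counted as adjacent to w. *)
have hub_sub : (q - #|C|%:R - #|Aw|%:R - #|Bw|%:R) * y w <=
    S + \sum_(z in Aw) y z + \sum_(z in Bw) y z.
  have [_ /(_ w) + _ _ _] := uv_heavy.
  rewrite big_mkcond (sum_cells e_sym e_irr e_uv) /=.
  have [/negPf uw /negPf vw] : ~~ e u w /\ ~~ e v w.
    by move: wW; rewrite in_remote => /and4P [-> ->].
  rewrite [e w u]e_sym [e w v]e_sym uw vw W1' big_set1 e_irr.
  have -> : \sum_(z in A) (if e w z then y w + y z else 0) =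
      #|Aw|%:R * y w + \sum_(z in Aw) y z.
    rewrite mulr_natl -sumr_const -big_split /= -big_mkcondr.
    by apply: eq_bigl => z; rewrite [RHS]inE.
  have -> : \sum_(z in B) (if e w z then y w + y z else 0) =
      #|Bw|%:R * y w + \sum_(z in Bw) y z.
    rewrite mulr_natl -sumr_const -big_split /= -big_mkcondr.
    by apply: eq_bigl => z; rewrite [RHS]inE.
  have : \sum_(z in C) (if e w z then y w + y z else 0) <= #|C|%:R * y w + S.
    rewrite mulr_natl -sumr_const -big_split /=; apply: ler_sum => z _.
    by case: ifP => // _; rewrite addr_ge0.
  by lra.
have deg_sum (D : {set 'I_n}) k : (\sum_(x in D) deg e x <= k)%N ->
    q * \sum_(z in D) y z <= k%:R.
  rewrite -(ler_nat R) natr_sum mulr_sumr; apply: le_trans.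
  by apply: ler_sum => z _; apply: heavy_le_deg uv_heavy z.
have hA := deg_sum _ _ (remote_private_deg e_sym e_irr e_free e_uv W1' (ltnW w4)).
have hB : q * \sum_(z in Bw) y z <= (2 * #|Bw| + #|A|)%:R.
  apply/deg_sum/(remote_private_deg e_sym e_irr e_free e_vu).
    by rewrite remoteC.
  by rewrite common_nbrsC ltnW.
have aw : #|Aw|%:R <= #|A|%:R :> R.
  rewrite ler_nat subset_leq_card //; apply/fintype.subsetP => z.
  by rewrite [z \in _]inE => /andP [].
have bw : #|Bw|%:R <= #|B|%:R :> R.
  rewrite ler_nat subset_leq_card //; apply/fintype.subsetP => z.
  by rewrite [z \in _]inE => /andP [].
rewrite natrD natrM -/Aw in hA; rewrite natrD natrM in hB.
move: hA hB aw bw hub_sub q3 hN hS hle1 (y_ge0 w) (ler0n R #|A|) (ler0n R #|B|).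
rewrite W1; move: (ler0n R #|C|) q8 qn qK.
move: (\sum_(z in Aw) _) (\sum_(z in Bw) _) (\sum_(z in C) _).
move: #|Aw|%:R #|Bw|%:R #|A|%:R #|B|%:R #|C|%:R n%:R (y w).
move=> a' b' a b c N x YA YB s c0 h8 hn hK hA hB ha' hb' hx hq3 hN hs' x1 x0 a0 b0.
(* Uses (q - n + 1)(q - 3) = (q - n)(q - 2) + n - 3 and [large_index_gap]. *)
have h1 : 3 * N - 7 < 2 * c * (1 + x) by nra.
have h2 : 4 * (a + b) < N - 5.
  have : c * x <= c by rewrite ler_piMr.
  by nra.
have h3 : YA + YB <= 3 / 4 by nra.
have h4 : s <= 1 + x.
  have h : c * (1 + x) <= (q - 3) * (1 + x) by rewrite ler_wpM2r; lra.
  by rewrite -(ler_pM2l (_ : 0 < q - 3)); lra.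
(* Since u, v and w lie outside A, B and C, the factor is at least q - n + 3 >= 4.73. With [h3] and
   [h4] this leaves 3.73 x <= 1.75. *)
have h5 : (473 / 100) * x <= (q - c - a' - b') * x by rewrite ler_wpM2r; lra.
have h6 : x <= 47 / 100 by lra.
have h7 : c * (1 + x) <= c * (147 / 100) by rewrite ler_wpM2l; lra.
by lra.
Qed.

End Hub.
End RemoteHub.

(** * Three common neighbours *)

Lemma sum_set3 (V : nmodType) (T : finType) (D : {set T}) (F : T -> V) a b d :
  #|D| = 3%N -> a \in D -> b \in D -> d \in D -> uniq [:: a; b; d] ->
  \sum_(x in D) F x = F a + F b + F d.
Proof.
move=> D3 aD bD dD us; rewrite -addrA.
have -> : D = [set x in [:: a; b; d]].
  apply/eqP; rewrite eq_sym eqEcard D3 cardsE (card_uniqP us) leqnn andbT.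
  by apply/fintype.subsetP => x; rewrite !inE => /or3P [] /eqP ->.
rewrite (eq_bigl (fun x => x \in [:: a; b; d])); last by move=> x; rewrite inE.
by rewrite -big_uniq //= !big_cons big_nil addr0.
Qed.

Section ThreeCommon.
Context (R : realType) (n : nat).
Variables (e : rel 'I_n) (q : R) (y : 'I_n -> R) (u v : 'I_n).
Hypotheses (e_sym : symmetric e) (e_irr : irreflexive e).
Hypothesis e_free : ~ has_trebly_chorded_cycle_at_vertex e.
Hypothesis q_large : large_index n q.
Hypothesis uv_heavy : heavy_edge e q y u v.

Local Notation C := (common e u v).
Local Notation W := (remote e u v).
Local Notation S := (\sum_(x in C) y x).
Local Notation g := (common_weight e y u v).

Let e_uv : e u v. Proof. by case: uv_heavy. Qed.
Let y_ge0 w : 0 <= y w. Proof. by case: uv_heavy. Qed.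

Variables c1 c2 : 'I_n.
Hypotheses (C3 : #|C| = 3%N) (c1C : c1 \in C) (c2C : c2 \in C) (e12 : e c1 c2).

(** In a triangle every c lies on two edges, each counted twice, so the edges inside C weigh 4 S in
    total, and a remote vertex sees at most one vertex of C. With two edges the total is at most 4
    and a remote vertex sees at most two vertices of C, whence 3 + 4 = 7; a single edge fits the
    same bounds because |W| <= 1. *)
Lemma three_common_bound : exists c3, [/\ c3 \in C, uniq [:: c1; c2; c3] &
   if e c1 c3 && e c2 c3 then (q - 6) * S <= 3 + #|W|%:R
   else ((q - 6) * S <= 3 + 3 * #|W|%:R) && ((q - 2) * S <= 7 + 2 * #|W|%:R)].
Proof.
have c12 := adjacent_neq e_irr e12.
have [c3 c3C] := @exists_notin _ C [:: c1; c2] (eq_leq (esym C3)).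
rewrite !inE negb_or => /andP [n31 n32]; exists c3.
have us : uniq [:: c1; c2; c3] by rewrite /= !inE negb_or c12 ![_ == c3]eq_sym n31 n32.
have sum3 F : \sum_(x in C) F x = F c1 + F c2 + F c3 :> R by apply: sum_set3.
have c3' : (2 < #|C|)%N by rewrite C3.
have [sA sB] := common_edge_sum_private0 e_sym e_irr e_free uv_heavy c3' c1C c2C e12.
split=> //; have := heavy_common_sum e_sym e_irr uv_heavy.
have gE x : g x = (if e c1 x then y c1 + y x else 0)
    + (if e c2 x then y c2 + y x else 0) + (if e c3 x then y c3 + y x else 0).
  by rewrite /common_weight big_mkcondr /= sum3.
have edge_le x z : e x z -> y x + y z <= 1 by case: uv_heavy => _ _ _ _; apply.
have W2 : (#|W| <= 1)%N.
  by have := common_large e_sym e_irr q_large uv_heavy; rewrite C3 addn2 !ltnS.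
have gW1 : \sum_(x in W) g x <= 3 * #|W|%:R.
  rewrite -natrM; apply: (sum_weight_le uv_heavy) => x _.
  by rewrite -C3 subset_leq_card //; apply/fintype.subsetP => z;
    rewrite in_common_nbrs => /andP [].
(* A remote vertex cannot see both ends of the edge a b once b has a further neighbour d in C. *)
have path_remote a b d : a \in C -> b \in C -> d \in C -> a != d -> e b a -> e b d ->
    forall w, w \in W -> e a w -> e b w = false.
  move=> aC bC dC ad ba bd w wW aw; apply/negP => bw.
  by apply: (common_path_remote e_sym e_irr e_free e_uv wW aC bC dC ad ba bd);
    rewrite e_sym.
have gw_le w : g w <= (e c1 w + e c2 w + e c3 w)%:R.
  have ind x : (if e x w then y x + y w else 0) <= (e x w)%:R.
    by case: ifP => // /edge_le.
  by rewrite gE !natrD; do !apply: lerD.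
have sumW k : (forall w, w \in W -> e c1 w + e c2 w + e c3 w <= k)%N ->
    \sum_(x in W) g x <= k%:R * #|W|%:R.
  move=> hk; rewrite mulr_natr -sumr_const; apply: ler_sum => w /hk wk.
  by apply: le_trans (gw_le w) _; rewrite ler_nat.
have n13 : c1 != c3 by rewrite eq_sym.
have n23 : c2 != c3 by rewrite eq_sym.
have e21 : e c2 c1 by rewrite e_sym.
have Wle1 : #|W|%:R <= 1 :> R by rewrite (ler_nat R _ 1).
rewrite !sum3 sA sB C3 !gE !e_irr e12 e21 ![e c3 _]e_sym.
move: gW1 (edge_le _ _ e12) (y_ge0 c1) (y_ge0 c2) (y_ge0 c3) Wle1.
have [e13|e13] := boolP (e c1 c3); have [e23|e23] /= := boolP (e c2 c3).
- have e31 : e c3 c1 by rewrite e_sym.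
  have e32 : e c3 c2 by rewrite e_sym.
  have := sumW 1%N; move: (\sum_(x in W) _) => gW hW.
  have {hW} : gW <= 1%:R * #|W|%:R.
    apply: hW => w wW.
    have := path_remote c1 c2 c3 c1C c2C c3C n13 e21 e23 w wW.
    have := path_remote c1 c3 c2 c1C c3C c2C c12 e31 e32 w wW.
    have := path_remote c2 c3 c1 c2C c3C c1C _ e32 e31 w wW; rewrite eq_sym c12.
    case: (e c1 w); case: (e c2 w); case: (e c3 w) => // h1 h2 h3.
    - by have := h2 isT.
    - by have := h3 isT.
    - by have := h2 isT.
    - by have := h1 isT isT.
  by lra.
- have := sumW 2%N; move: (\sum_(x in W) _) => gW hW.
  have {hW} : gW <= 2%:R * #|W|%:R.
    apply: hW => w wW; have := path_remote c2 c1 c3 c2C c1C c3C n23 e12 e13 w wW.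
    by case: (e c1 w); case: (e c2 w); case: (e c3 w) => // h1; have := h1 isT.
  by move: (edge_le _ _ e13) => *; apply/andP; split; lra.
- have := sumW 2%N; move: (\sum_(x in W) _) => gW hW.
  have {hW} : gW <= 2%:R * #|W|%:R.
    apply: hW => w wW; have := path_remote c1 c2 c3 c1C c2C c3C n13 e21 e23 w wW.
    by case: (e c1 w); case: (e c2 w); case: (e c3 w) => // h1; have := h1 isT.
  by move: (edge_le _ _ e23) => *; apply/andP; split; lra.
by move: (\sum_(x in W) _) => *; apply/andP; split; lra.
Qed.

End ThreeCommon.

(** Here q - 6 >= 3.73, and 3.73 (1.73 + r) exceeds 2 (3 + r). *)
Lemma detached_gap (R : realType) (N q r s : R) : 8 <= N -> N + 173 / 100 <= q ->
  0 <= r -> q - N + r <= 2 * s -> ~ (q - 6) * s <= 3 + r.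
Proof.
move=> N8 qN r0 h1 h2.
have h4 : (q - N + r) * (q - 6) <= 2 * s * (q - 6) by rewrite ler_wpM2r; lra.
have h5 : (173 / 100 + r) * (q - 6) <= (q - N + r) * (q - 6).
  by rewrite ler_wpM2r; lra.
have h6 : (173 / 100 + r) * (373 / 100) <= (173 / 100 + r) * (q - 6).
  by rewrite ler_wpM2l; lra.
lra.
Qed.

(** The margin is thin: 2.73 * 6.73 is about 18.37, against 18. *)
Lemma path_gap (R : realType) (N q s : R) : 7 <= N -> N + 173 / 100 <= q ->
  q - N + 1 <= 2 * s -> (q - 2) * s <= 7 + 2 * 1 -> False.
Proof.
move=> N8 qN h1 h2.
have h4 : (q - N + 1) * (q - 2) <= 2 * s * (q - 2) by rewrite ler_wpM2r; lra.
have h5 : (173 / 100 + 1) * (q - 2) <= (q - N + 1) * (q - 2).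
  by rewrite ler_wpM2r; lra.
lra.
Qed.

Lemma seven_cells a b r : (7 = 2 + a + b + 3 + r)%N -> (r <= 1)%N ->
  [\/ [/\ a = 2, b = 0 & r = 0], [/\ a = 1, b = 1 & r = 0],
      [/\ a = 0, b = 2 & r = 0] |
      r = 1 /\ (a = 1 /\ b = 0 \/ a = 0 /\ b = 1)]%N.
Proof.
case: r => [|[|r]] //; last by move=> h _; constructor 4; lia.
by case: a => [|[|[|a]]] h _;
  [constructor 3 | constructor 2 | constructor 1 | exfalso]; split || idtac; lia.
Qed.

Section DetachedPrivate.
Context (R : realType) (n : nat).
Variables (e : rel 'I_n) (q : R) (y : 'I_n -> R) (u v : 'I_n).
Hypotheses (e_sym : symmetric e) (e_irr : irreflexive e).
Hypothesis e_free : ~ has_trebly_chorded_cycle_at_vertex e.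
Hypothesis q_large : large_index n q.
Hypothesis uv_heavy : heavy_edge e q y u v.

Local Notation C := (common e u v).
Local Notation A := (private e u v).
Local Notation B := (private e v u).
Local Notation W := (remote e u v).

Let e_uv : e u v. Proof. by case: uv_heavy. Qed.
Let y_ge0 w : 0 <= y w. Proof. by case: uv_heavy. Qed.

Hypothesis priv0 : forall z x, z \in C -> x \in A :|: B -> e x z = false.

Lemma detached_deg x : x \in A -> (deg e x <= #|A| + #|B| + #|W|)%N.
Proof.
move=> xA; set D := A :|: B :|: W.
have xD : x \in D by rewrite !finset.in_setU xA.
have sub : [set z | e x z] \subset u |: (D :\ x).
  apply/fintype.subsetP => z; rewrite !inE => xz.
  have [//|zu] := eqVneq z u; rewrite eq_sym (adjacent_neq e_irr xz) /=.
  have xv : ~~ e x v by move: xA; rewrite e_sym in_private => /and3P [].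
  have zv : z != v by apply: contraTneq xz => ->.
  case uz: (e u z); case vz: (e v z); rewrite ?zv //=.
  have zC : z \in C by rewrite in_common uz.
  by have := @priv0 z x zC; rewrite finset.in_setU xA xz => /(_ isT).
apply: leq_trans (subset_leq_card sub) _; rewrite cardsU1.
apply: leq_trans (_ : 1 + #|D :\ x| <= _)%N; first by rewrite leq_add2r leq_b1.
have -> : (1 + #|D :\ x| = #|D|)%N by rewrite [RHS](cardsD1 x) xD.
rewrite /D cardsU; apply: leq_trans (leq_subr _ _) _; rewrite leq_add2r.
by rewrite cardsU leq_subr.
Qed.

(** Each vertex of A sees only u and possibly the other vertex of A. This is the configuration of
    K_1 joined to K_4 and K_2, with u the dominating vertex and A the K_2. *)
Lemma detached_pair_sum : #|A| = 2%N -> #|B| = 0%N -> #|W| = 0%N ->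
  (q - 3) * \sum_(x in A) y x <= 2 * y u.
Proof.
move=> A2 /eqP; rewrite cards_eq0 => /eqP B0 /eqP; rewrite cards_eq0 => /eqP W0.
have bound x : x \in A -> q * y x <= y x + y u + \sum_(z in A) y z.
  move=> xA; have [_ /(_ x) + _ _ _] := uv_heavy.
  rewrite big_mkcond (sum_cells e_sym e_irr e_uv) /= B0 W0 !big_set0.
  rewrite [\sum_(z in C) _]big1; last first.
    by move=> z zC; rewrite priv0 // finset.in_setU xA.
  have := xA; rewrite in_private => /and3P [ux /negPf vx _].
  rewrite [e x u]e_sym [e x v]e_sym ux vx.
  suff : \sum_(z in A) (if e x z then y x + y z else 0) <= \sum_(z in A) y z by lra.
  have := A2; rewrite (cardsD1 x) xA => -[] /eqP /cards1P [z AE].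
  rewrite !(bigD1 x xA) /= e_irr add0r.
  have zE : (fun i => (i \in A) && (i != x)) =1 pred1 z.
    by move=> i; rewrite andbC -finset.in_setD1 AE finset.in_set1.
  by rewrite !(big_pred1 z) //; case: ifP => // _; have := y_ge0 x; have := y_ge0 z; lra.
have : \sum_(x in A) q * y x <= \sum_(x in A) (y x + y u + \sum_(z in A) y z).
  exact: ler_sum.
rewrite -mulr_sumr !big_split /= !sumr_const A2.
by lra.
Qed.

End DetachedPrivate.

Section ThreeContra.
Context (R : realType) (n : nat).
Variables (e : rel 'I_n) (q : R) (y : 'I_n -> R) (u v : 'I_n).
Hypotheses (e_sym : symmetric e) (e_irr : irreflexive e).
Hypothesis e_free : ~ has_trebly_chorded_cycle_at_vertex e.
Hypothesis q_large : large_index n q.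
Hypothesis uv_heavy : heavy_edge e q y u v.

Local Notation C := (common e u v).
Local Notation A := (private e u v).
Local Notation B := (private e v u).
Local Notation W := (remote e u v).
Local Notation S := (\sum_(x in C) y x).

Let qn : n%:R + 173 / 100 <= q. Proof. by case: q_large. Qed.
Let e_uv : e u v. Proof. by case: uv_heavy. Qed.
Let y_ge0 w : 0 <= y w. Proof. by case: uv_heavy. Qed.
Let vu_heavy := heavy_edgeC e_sym uv_heavy.

Variables c1 c2 : 'I_n.
Hypotheses (C3 : #|C| = 3%N) (c1C : c1 \in C) (c2C : c2 \in C) (e12 : e c1 c2).
Hypothesis n7 : (7 <= n)%N.

(* Tightest at n = 7: K_1 \/ (K_4 U K_2) has index about 8.70, against 8.735 for
   K_{1,1,5}^+, hence the separate estimates there. *)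
Lemma three_common_contra : False.
Proof.
have hN := cells_natr e_sym e_irr uv_heavy; have hS := heavy_sum e_sym e_irr uv_heavy.
have W1 : (#|W| <= 1)%N.
  by have := common_large e_sym e_irr q_large uv_heavy; rewrite C3 addn2 !ltnS.
have priv0 z x : z \in C -> x \in A :|: B -> e x z = false.
  have c3 : (2 < #|C|)%N by rewrite C3.
  move=> zC xAB.
  have := common_edge_private0 e_sym e_irr e_free uv_heavy c3 c1C c2C e12 xAB.
  move=> /eqP; rewrite cards_eq0 => /eqP/setP/(_ z).
  by rewrite in_common_nbrs zC inE e_sym.
have priv0' z x : z \in common e v u -> x \in B :|: A -> e x z = false.
  by rewrite commonC finset.setUC; apply: priv0.
have hsum := heavy_sum_le e_sym e_irr uv_heavy.
(* A large S forces y_v up, and with it the losses y_v - y_x over A; [Su] does the same for B. *)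
have Sv : S <= 3 * y v.
  rewrite mulr_natl -C3 -sumr_const; apply: ler_sum => x xC.
  by have [] := heavy_common_le uv_heavy xC.
have Su : S <= 3 * y u.
  rewrite mulr_natl -C3 -sumr_const; apply: ler_sum => x xC.
  by have [] := heavy_common_le uv_heavy xC.
have y_uv : y u + y v = 1 by case: uv_heavy.
have [c3 [_ _ bound]] :=
  three_common_bound e_sym e_irr e_free q_large uv_heavy C3 c1C c2C e12.
have degA : q * \sum_(x in A) y x <= (#|A| * (#|A| + #|B| + #|W|))%:R.
  rewrite mulr_sumr -sum_nat_const natr_sum; apply: ler_sum => x xA.
  apply: le_trans (heavy_le_deg uv_heavy x) _; rewrite ler_nat.
  exact: (detached_deg e_sym e_irr priv0).
have degB : q * \sum_(x in B) y x <= (#|B| * (#|B| + #|A| + #|W|))%:R.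
  rewrite mulr_sumr -sum_nat_const natr_sum; apply: ler_sum => x xB.
  apply: le_trans (heavy_le_deg uv_heavy x) _; rewrite ler_nat.
  by have := detached_deg e_sym e_irr priv0' xB; rewrite remoteC.
have YA0 : 0 <= \sum_(x in A) y x by apply: sumr_ge0.
have YB0 : 0 <= \sum_(x in B) y x by apply: sumr_ge0.
have S0 : 0 <= S by apply: sumr_ge0.
rewrite !sumrB !sumr_const -[y v *+ _]mulr_natl -[y u *+ _]mulr_natl in hS.
have hnat := card_cells e_sym e_irr e_uv; rewrite C3 in hnat.
have N7 : 7 <= n%:R :> R by rewrite (ler_nat R 7).
have r0 : 0 <= #|W|%:R :> R by [].
have [n8|n8] := leqP 8 n.
  have N8 : 8 <= n%:R :> R by rewrite (ler_nat R 8).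
  have tri : ~ (q - 6) * S <= 3 + #|W|%:R by apply: (detached_gap N8 qn r0 hsum).
  move: bound; case: ifP => _ // /andP [h1 h2].
  have [W0|W0] := posnP #|W|; first by apply: tri; move: h1; rewrite W0; lra.
  have WE : #|W| = 1%N by apply/eqP; rewrite eqn_leq W1.
  rewrite WE in h2 hsum.
  exact: (path_gap N7 qn hsum h2).
have nE : n = 7%N by apply/eqP; rewrite eqn_leq n7 -ltnS n8.
have {}N7 : n%:R = 7 :> R by rewrite nE.
rewrite N7 in hS hsum; have qn7 : 7 + 173 / 100 <= q by rewrite -N7.
have {}hnat := etrans (esym nE) hnat.
have Q3 Y : 0 <= Y -> 573 / 100 * Y <= (q - 3) * Y.
  by move=> Y0; rewrite ler_wpM2r //; lra.
have QY Y : 0 <= Y -> 873 / 100 * Y <= q * Y.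
  by move=> Y0; rewrite ler_wpM2r //; lra.
have hA := Q3 _ YA0; have hB := Q3 _ YB0.
have hA' := QY _ YA0; have hB' := QY _ YB0.
have Q6 : 273 / 100 * S <= (q - 6) * S by rewrite ler_wpM2r //; lra.
have bound0 : #|W| = 0%N -> (q - 6) * S <= 3.
  by move=> W0; move: bound; rewrite W0; case: ifP => _; [lra | case/andP; lra].
rewrite natrM !natrD in degA; rewrite natrM !natrD in degB.
case: (seven_cells hnat W1) => [[aE bE rE]|[aE bE rE]|[aE bE rE]|[rE abE]].
(* The degree bound would only give q times the sum over A at most 4, which is too weak here. *)
- have hp := detached_pair_sum e_sym e_irr uv_heavy priv0 aE bE rE.
  by move: (bound0 rE) hS degA degB; rewrite aE bE rE; lra.
- move: (bound0 rE) hS degA degB; rewrite aE bE rE; lra.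
- have rE' : #|remote e v u| = 0%N by rewrite remoteC.
  have hp := detached_pair_sum e_sym e_irr vu_heavy priv0' bE aE rE'.
  by move: (bound0 rE) hS degA degB; rewrite aE bE rE; lra.
rewrite rE in bound hS hsum.
have {}bound : (q - 6) * S <= 4.
  move: bound; case: ifP => _; first by lra.
  by case/andP=> _ h2; case: (path_gap _ qn7 hsum h2); lra.
by case: abE => -[aE bE]; move: hS degA degB; rewrite aE bE rE; lra.
Qed.

End ThreeContra.

(** * Two common neighbours *)

Lemma degree_room n a b d : (n = 4 + a + b -> 0 < b -> d < a -> d + 6 <= n)%N.
Proof. by lia. Qed.

Lemma room_nine n d d' : (d <= 4 -> d' + 6 <= n -> 6 < d + d' -> 9 <= n)%N.
Proof. by lia. Qed.

Lemma room_nine_contra n d d' :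
  (n <= 9 -> d + 6 <= n -> d' + 6 <= n -> 6 < d + d' -> False)%N.
Proof. by lia. Qed.

Lemma room_seven n a d1 d2 : (7 <= n -> n = 4 + a -> (7 < n -> 8 < d1 + d2) ->
  d1 <= 4 -> d2 <= 4 -> a = 3)%N.
Proof. by lia. Qed.

Lemma room_pred a b k : (3 = a + b -> 0 < a -> b = k.+1 -> 2 + k <= 3)%N.
Proof. by lia. Qed.

Lemma room_three k b : (3 = 2 + k + b -> 0 < b -> k = 0 /\ b = 1)%N.
Proof. by lia. Qed.

Section TwoCommon.
Variables (n : nat) (e : rel 'I_n).
Hypotheses (e_sym : symmetric e) (e_irr : irreflexive e).
Hypothesis e_free : ~ has_trebly_chorded_cycle_at_vertex e.
Local Open Scope nat_scope.

Lemma deg_le_seq x (s : seq 'I_n) : (forall z, e x z -> z \in s) -> deg e x <= size s.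
Proof.
move=> xs; rewrite /deg; apply: leq_trans (card_size s); apply: subset_leq_card.
by apply/fintype.subsetP => z; rewrite inE => /xs.
Qed.

Lemma deg_le_set x (s : seq 'I_n) (D : {set 'I_n}) :
  (forall z, e x z -> (z \in s) || (z \in D)) -> deg e x <= size s + #|D|.
Proof.
move=> xs; rewrite /deg.
have sub : [set z | e x z] \subset [set z in s] :|: D.
  by apply/fintype.subsetP => z; rewrite !inE => /xs.
apply: leq_trans (subset_leq_card sub) _; rewrite cardsU.
apply: leq_trans (leq_subr _ _) _; rewrite leq_add2r cardsE.
exact: card_size.
Qed.

Definition two_common u v c1 c2 := [/\ e u v, c1 != c2,
  common e u v = [set c1; c2] & remote e u v = finset.set0].

Lemma two_commonC u v c1 c2 : two_common u v c1 c2 -> two_common v u c1 c2.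
Proof. by case=> uv c12 CE W0; split; rewrite // 1?e_sym 1?commonC 1?remoteC. Qed.

Lemma two_common_swap u v c1 c2 : two_common u v c1 c2 -> two_common u v c2 c1.
Proof.
by case=> uv c12 CE W0; split; rewrite // 1?eq_sym // finset.setUC.
Qed.

Section View.
Variables u v c1 c2 : 'I_n.
Hypothesis tc : two_common u v c1 c2.
Local Notation A := (private e u v).
Local Notation B := (private e v u).

Let e_uv : e u v. Proof. by case: tc. Qed.
Let c12 : c1 != c2. Proof. by case: tc. Qed.
Let c1C : c1 \in common e u v.
Proof. by case: tc => _ _ -> _; rewrite !inE eqxx. Qed.
Let c2C : c2 \in common e u v.
Proof. by case: tc => _ _ -> _; rewrite !inE eqxx orbT. Qed.

Lemma two_common_card : n = 4 + #|A| + #|B|.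
Proof.
have := card_cells e_sym e_irr e_uv; case: tc => _ _ -> ->.
rewrite cards0 cards2 c12; move: #|A| #|B| => a b ->.
by rewrite addn0 addnC addnA addnA.
Qed.

Lemma two_common_cases z :
  [|| z == u, z == v, z == c1, z == c2, z \in A | z \in B].
Proof.
have := finset.in_set0 z; case: tc => _ _ CE <-.
have := finset.in_set2 z c1 c2; rewrite -CE in_common in_remote !in_private.
case: (z == u); case: (z == v); case: (z == c1); case: (z == c2) => //=.
by case: (e u z); case: (e v z).
Qed.

Lemma private_nbr x z : x \in A -> e x z ->
  [\/ z \in [:: u; c1; c2], z \in A | z \in B].
Proof.
move=> xA xz; have xv : ~~ e x v by move: xA; rewrite e_sym in_private => /and3P [].
have := two_common_cases z; case/or4P => [/eqP ->|/eqP zv|/eqP ->|].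
- by constructor 1; rewrite inE eqxx.
- by move: xv; rewrite -zv xz.
- by constructor 1; rewrite !inE eqxx orbT.
case/or3P => [/eqP ->|zA|zB]; [constructor 1 | constructor 2 | constructor 3] => //.
by rewrite !inE eqxx !orbT.
Qed.

Lemma common_nbr z : e c1 z ->
  [\/ z \in [:: u; v], z = c2, z \in A | z \in B].
Proof.
move=> cz; have := two_common_cases z.
case/or4P => [/eqP ->|/eqP ->|/eqP zc|].
- by constructor 1; rewrite inE eqxx.
- by constructor 1; rewrite !inE eqxx orbT.
- by move: cz; rewrite zc e_irr.
by case/or3P => [/eqP ->|zA|zB]; [constructor 2 | constructor 3 | constructor 4].
Qed.

(** Otherwise z, x, c1, v, c2 is a forbidden path around u. Below, a private vertex adjacent to c1
    or c2 is called attached. *)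
Lemma attached_no_private x z : x \in A -> e x c1 -> z \in A -> ~~ e x z.
Proof.
move=> xA xc zA; apply/negP => xz.
exact: (private_common_private e_sym e_irr e_free e_uv xA zA c1C c2C).
Qed.

Lemma no_matching x x' : x \in A -> x' \in A -> e x c1 -> e x' c2 -> x = x'.
Proof.
move=> xA x'A xc x'c; apply/eqP/negPn/negP => xx'.
exact: (private_common_matching e_sym e_irr e_free e_uv xA x'A c1C c2C).
Qed.

End View.

Lemma attached_no_private2 u v c1 c2 x z : two_common u v c1 c2 ->
  x \in private e u v -> e x c1 || e x c2 -> z \in private e u v -> ~~ e x z.
Proof.
move=> tc xA /orP [xc|xc]; first exact: (attached_no_private tc).
exact: (attached_no_private (two_common_swap tc)).
Qed.

(** * Two adjacent common neighbours *)

Section AdjacentCommon.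
Variables u v c1 c2 : 'I_n.
Hypotheses (tc : two_common u v c1 c2) (e12 : e c1 c2).
Local Notation A := (private e u v).
Local Notation B := (private e v u).
Let e_uv : e u v. Proof. by case: tc. Qed.
Let c1C : c1 \in common e u v.
Proof. by case: tc => _ _ -> _; rewrite !inE eqxx. Qed.
Let c2C : c2 \in common e u v.
Proof. by case: tc => _ _ -> _; rewrite !inE eqxx orbT. Qed.

(** Otherwise x', b, v, c2, c1, x, possibly with c1 and c2 exchanged, is forbidden around u. Thus an
    attached vertex is the only one of its side that can have neighbours across. *)
Lemma attached_across x x' b : x \in A -> e x c1 || e x c2 -> x' \in A ->
  x != x' -> b \in B -> ~~ e b x'.
Proof.
move=> xA + x'A xx' bB; have e21 : e c2 c1 by rewrite e_sym.
case/orP => xc; apply/negP => bx'.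
  exact: (private_edge_across e_sym e_irr e_free e_uv xA x'A bB c1C c2C).
exact: (private_edge_across e_sym e_irr e_free e_uv xA x'A bB c2C c1C).
Qed.

(** The vertex x' excludes c2 by [no_matching] and all of B by [attached_across], leaving u and
    c1. *)
Lemma attached_twice_deg x x' : x \in A -> x' \in A -> x != x' ->
  e x c1 || e x c2 -> e x' c1 -> deg e x <= 2.
Proof.
move=> xA x'A xx' xc x'c; apply: (@deg_le_seq x [:: u; c1]) => z xz.
have xc2 : ~~ e x c2.
  apply/negP => xc2; move: xx'; rewrite -[x](no_matching tc x'A xA x'c xc2) eqxx.
  by [].
case: (private_nbr tc xA xz) => [|zA|zB].
- rewrite !inE => /or3P [->|->|/eqP zE]; rewrite ?orbT //.
  by move: xc2; rewrite -zE xz.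
- by have := attached_no_private2 tc xA xc zA; rewrite xz.
have := @attached_across x' x z x'A _ xA _ zB; rewrite x'c eq_sym xx' [e z x]e_sym xz.
by move=> /(_ isT isT).
Qed.

End AdjacentCommon.

(* The degree bounds forced by the inequalities when |C| = 2 (and so W is empty):
   there 2 (y_c1 + y_c2) >= q - n >= 1.73, while every y_c is at most 1/2. *)
Definition dense_pair u v c1 c2 :=
  [/\ 7 <= n, {in private e u v :|: private e v u &, forall x x', x != x' ->
       6 < deg e x + deg e x'},
     3 < deg e c1, 3 < deg e c2 &
     (7 < n -> 8 < deg e c1 + deg e c2) /\ (9 < n -> 10 < deg e c1 + deg e c2)].

Lemma dense_pairC u v c1 c2 : dense_pair u v c1 c2 -> dense_pair v u c1 c2.
Proof. by case=> n7 h d1 d2 d12; split; rewrite // finset.setUC. Qed.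

Lemma dense_pair_swap u v c1 c2 : dense_pair u v c1 c2 -> dense_pair u v c2 c1.
Proof. by case=> n7 h d1 d2 [d12 d12']; split; rewrite // addnC. Qed.

Lemma card_privateU u v :
  #|private e u v :|: private e v u| = #|private e u v| + #|private e v u|.
Proof.
rewrite cardsU (_ : _ :&: _ = finset.set0) ?cards0 ?subn0 //.
apply/setP => z; rewrite finset.in_setI finset.in_set0 !in_private.
by case: (e u z); rewrite ?andbF.
Qed.

(** Two attached vertices on one side would both have degree at most 2, against the degree sum
    required by [dense_pair]. *)
Lemma attached_unique u v c1 c2 x x' : two_common u v c1 c2 ->
  dense_pair u v c1 c2 -> e c1 c2 -> x \in private e u v ->
  x' \in private e u v -> e x c1 || e x c2 -> e x' c1 || e x' c2 -> x = x'.
Proof.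
move=> tc [_ dns _ _ _] e12 xA x'A xc x'c; apply/eqP/negPn/negP => xx'.
have tc' := two_common_swap tc; have e21 : e c2 c1 by rewrite e_sym.
have low z z' : z \in private e u v -> z' \in private e u v -> z != z' ->
    e z c1 || e z c2 -> e z' c1 || e z' c2 -> deg e z <= 2.
  move=> zA z'A zz' zc /orP [] z'c.
    exact: (attached_twice_deg tc e12 zA z'A zz' zc z'c).
  by apply: (attached_twice_deg tc' e21 zA z'A zz' _ z'c); rewrite orbC.
have xx : x' != x by rewrite eq_sym.
have := dns x x'; rewrite !finset.in_setU xA x'A => /(_ isT isT xx').
by rewrite ltnNge (leq_trans (leq_add (low x x' _ _ _ _ _) (low x' x _ _ _ _ _))).
Qed.

(** Besides u, the vertex z can only see A without x and z. *)
Lemma unattached_deg u v c1 c2 x z : two_common u v c1 c2 ->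
  dense_pair u v c1 c2 -> e c1 c2 -> x \in private e u v ->
  z \in private e u v -> e x c1 || e x c2 -> z != x ->
  deg e z < #|private e u v|.
Proof.
move=> tc dp e12 xA zA xc zx.
have AE : #|private e u v| = 2 + #|private e u v :\ x :\ z|.
  by rewrite (cardsD1 x) xA (cardsD1 z) !inE zx -in_private zA.
rewrite AE add2n ltnS -add1n; apply: (@deg_le_set z [:: u]) => w zw.
have nz c : e z c -> c \in [:: c1; c2] -> false.
  move=> zc cE; have E : z = x; last by move: zx; rewrite E eqxx.
  apply: (attached_unique tc dp e12 zA xA _ xc).
  by move: zc; move: cE; rewrite !inE => /orP [] /eqP -> ->; rewrite ?orbT.
case: (private_nbr tc zA zw) => [|wA|wB].
- rewrite inE => /orP [/eqP ->|/(nz _ zw) //]; by rewrite inE eqxx.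
- rewrite !finset.in_setD1 wA andbT [w == z]eq_sym (adjacent_neq e_irr zw) /=.
  apply/orP; right; apply/negP => /eqP wx; move: zw; rewrite wx e_sym.
  by apply/negP/(attached_no_private2 tc xA xc zA).
have := attached_across tc e12 xA xc zA _ wB; rewrite eq_sym e_sym zw.
by move=> /(_ zx).
Qed.

(** Both c1 and c2 have degree at most 5, so n <= 9, and x has degree at most 4. Any further private
    z satisfies deg z <= n - 6, and pairing it with x forces n = 9; then two such vertices have
    degree sum at most 6. *)
Lemma adjacent_two_sides u v c1 c2 x x' : two_common u v c1 c2 ->
  dense_pair u v c1 c2 -> e c1 c2 -> x \in private e u v ->
  x' \in private e v u -> e x c1 || e x c2 -> e x' c1 || e x' c2 -> False.
Proof.
move=> tc dp e12 xA x'B xc x'c.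
have tcC := two_commonC tc; have dpC := dense_pairC dp.
have degc d1 d2 : two_common u v d1 d2 -> dense_pair u v d1 d2 -> e d1 d2 ->
    e x d1 || e x d2 -> e x' d1 || e x' d2 -> deg e d1 <= 5.
  move=> td dd d12 xd x'd.
  apply: (@deg_le_seq d1 [:: u; v; d2; x; x']) => z dz.
  have zd : e z d1 || e z d2 by rewrite e_sym dz.
  case: (common_nbr td dz) => [|->|zA|zB].
  - by rewrite !inE => /orP [->|->]; rewrite ?orbT.
  - by rewrite !inE eqxx !orbT.
  - by rewrite (attached_unique td dd d12 zA xA zd xd) !inE eqxx !orbT.
  by rewrite (attached_unique (two_commonC td) (dense_pairC dd) d12 zB x'B zd x'd)
    !inE eqxx !orbT.
have d1 := degc _ _ tc dp e12 xc x'c.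
have d2 : deg e c2 <= 5.
  by apply: (degc c2 c1 (two_common_swap tc) (dense_pair_swap dp));
    [rewrite e_sym | rewrite orbC | rewrite orbC].
have degx : deg e x <= 4.
  apply: (@deg_le_seq x [:: u; c1; c2; x']) => z xz.
  case: (private_nbr tc xA xz) => [|zA|zB].
  - by rewrite !inE => /or3P [] ->; rewrite ?orbT.
  - by move: xz; rewrite (negPf (attached_no_private2 tc xA xc zA)).
  have [->|zx'] := eqVneq z x'; first by rewrite !inE eqxx !orbT.
  have := attached_across tcC e12 x'B x'c zB _ xA; rewrite eq_sym zx' xz.
  by move=> /(_ isT).
have [n7 dns _ _ [_ n10]] := dp.
have n9 : n <= 9.
  rewrite leqNgt; apply/negP => /n10; rewrite ltnNge (leq_add d1 d2 : _ <= 10).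
  by [].
have nE := two_common_card tc.
have A0 : 0 < #|private e u v| by apply/card_gt0P; exists x.
have B0 : 0 < #|private e v u| by apply/card_gt0P; exists x'.
have cU := card_privateU u v.
have degz z : z \in private e u v :|: private e v u -> z \notin [:: x; x'] ->
    deg e z + 6 <= n.
  rewrite finset.in_setU => zAB; rewrite !inE negb_or => /andP [zx zx'].
  case/orP: zAB => [zA|zB].
    exact: degree_room nE B0 (unattached_deg tc dp e12 xA zA xc zx).
  apply: (degree_room _ A0 (unattached_deg tcC dpC e12 x'B zB x'c zx')).
  by rewrite addnAC; exact: nE.
have [nU nU'] : n = 4 + #|private e u v :|: private e v u| /\ 2 < n - 4.
  by rewrite cU addnA ltn_subRL; split => //; exact: leq_trans n7.
have U2 : 2 < #|private e u v :|: private e v u| by rewrite -(addKn 4 #|_|) -nU.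
have xU : x \in private e u v :|: private e v u by rewrite finset.in_setU xA.
have [z zU zN] := exists_notin (s := [:: x; x']) U2.
have dz := degz z zU zN.
have xz : x != z by move: zN; rewrite !inE negb_or eq_sym => /andP [].
have n9' := room_nine degx dz (dns x z xU zU xz).
have U3 : 3 < #|private e u v :|: private e v u|.
  by rewrite -(addKn 4 #|_|) -nU ltn_subRL (leq_trans _ n9').
have [z' z'U z'N] := exists_notin (s := [:: x; x'; z]) U3.
have zz' : z != z'.
  by rewrite eq_sym; move: z'N; rewrite !inE !negb_or => /and3P [].
apply: (room_nine_contra n9 dz _ (dns z z' zU z'U zz')); apply: degz => //.
by move: z'N; rewrite !inE !negb_or => /and3P [-> ->].
Qed.

(** Both c1 and c2 have degree at most 4, so n = 7 and there are three private vertices. The two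
    other than x have degree at most 3 each, again too small a sum. *)
Lemma adjacent_one_side u v c1 c2 x : two_common u v c1 c2 ->
  dense_pair u v c1 c2 -> e c1 c2 -> x \in private e u v ->
  e x c1 || e x c2 ->
  (forall z, z \in private e v u -> ~~ (e z c1 || e z c2)) -> False.
Proof.
move=> tc dp e12 xA xc Bfree; have e21 : e c2 c1 by rewrite e_sym.
have degc d1 d2 : two_common u v d1 d2 -> dense_pair u v d1 d2 -> e d1 d2 ->
    e x d1 || e x d2 -> (forall z, z \in private e v u -> ~~ (e z d1 || e z d2)) ->
    deg e d1 <= 4.
  move=> td dd d12 xd Bd; apply: (@deg_le_seq d1 [:: u; v; d2; x]) => z dz.
  have zd : e z d1 || e z d2 by rewrite e_sym dz.
  case: (common_nbr td dz) => [|->|zA|zB].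
  - by rewrite !inE => /orP [->|->]; rewrite ?orbT.
  - by rewrite !inE eqxx !orbT.
  - by rewrite (attached_unique td dd d12 zA xA zd xd) !inE eqxx !orbT.
  by move: (Bd z zB); rewrite zd.
have d1 := degc _ _ tc dp e12 xc Bfree.
have d2 : deg e c2 <= 4.
  apply: (degc c2 c1 (two_common_swap tc) (dense_pair_swap dp) e21).
    by rewrite orbC.
  by move=> z /Bfree; rewrite orbC.
have [n7 dns _ _ [n8 _]] := dp.
have nE : n = 4 + #|private e u v :|: private e v u|.
  by rewrite (card_privateU u v) addnA; exact: (two_common_card tc).
have U3 := room_seven n7 nE n8 d1 d2.
have A0 : 0 < #|private e u v| by apply/card_gt0P; exists x.
have cU := card_privateU u v; rewrite U3 in cU.
have degz z : z \in private e u v :|: private e v u -> z != x -> deg e z <= 3.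
  rewrite finset.in_setU => /orP [] zAB zx.
    apply: leq_trans (ltnW (unattached_deg tc dp e12 xA zAB xc zx)) _.
    by rewrite cU leq_addr.
  have : deg e z <= size [:: v; x] + #|private e v u :\ z|.
    apply: deg_le_set => w zw.
    have nc c : c \in [:: c1; c2] -> ~~ e z c.
      move=> cE; apply: contra (Bfree z zAB).
      by move: cE; rewrite !inE => /orP [] /eqP -> ->; rewrite ?orbT.
    case: (private_nbr (two_commonC tc) zAB zw) => [|wB|wA].
    - rewrite inE => /orP [/eqP ->|/nc]; first by rewrite inE eqxx.
      by rewrite zw.
    - by rewrite finset.in_setD1 wB eq_sym (adjacent_neq e_irr zw) orbT.
    have [->|wx] := eqVneq w x; first by rewrite !inE eqxx !orbT.
    have := attached_across tc e12 xA xc wA _ zAB; rewrite eq_sym wx zw.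
    by move=> /(_ isT).
  have BE : #|private e v u| = #|private e v u :\ z|.+1.
    by rewrite (cardsD1 z) zAB.
  by move/leq_trans; apply; apply: room_pred cU A0 BE.
have U2 : 1 < #|private e u v :|: private e v u| by rewrite U3.
have [z zU zN] := exists_notin (s := [:: x]) U2.
have U2' : 2 < #|private e u v :|: private e v u| by rewrite U3.
have [z' z'U z'N] := exists_notin (s := [:: x; z]) U2'.
rewrite inE in zN; move: z'N; rewrite !inE negb_or => /andP [z'x z'z].
have := dns z' z z'U zU z'z; rewrite ltnNge.
by rewrite (leq_add (degz z' z'U z'x) (degz z zU zN) : _ <= 6).
Qed.

Lemma adjacent_contra u v c1 c2 : two_common u v c1 c2 ->
  dense_pair u v c1 c2 -> e c1 c2 -> False.
Proof.
move=> tc dp e12.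
have side u' v' x : two_common u' v' c1 c2 -> dense_pair u' v' c1 c2 ->
    x \in private e u' v' -> e x c1 || e x c2 -> False.
  move=> tc' dp' xA xc.
  have [[x' x'B x'c]|noB] := pselect (exists2 x', x' \in private e v' u' &
      e x' c1 || e x' c2).
    exact: (adjacent_two_sides tc' dp' e12 xA x'B xc x'c).
  apply: (adjacent_one_side tc' dp' e12 xA xc) => z zB.
  by apply/negP => zc; apply: noB; exists z.
have [_ _ d1 _ _] := dp.
suff : deg e c1 <= 3 by rewrite leqNgt d1.
apply: (@deg_le_seq c1 [:: u; v; c2]) => z cz.
have zc : e z c1 || e z c2 by rewrite e_sym cz.
case: (common_nbr tc cz) => [|->|zA|zB].
- by rewrite !inE => /orP [->|->]; rewrite ?orbT.
- by rewrite !inE eqxx !orbT.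
- by case: (side u v z tc dp zA zc).
by case: (side v u z (two_commonC tc) (dense_pairC dp) zB zc).
Qed.

(** * Two non-adjacent common neighbours *)

Lemma apart_pair u v c1 c2 x x' : two_common u v c1 c2 ->
  dense_pair u v c1 c2 -> ~~ e c1 c2 -> x \in private e u v ->
  x' \in private e u v -> x != x' -> e x c1 -> e x' c1 -> False.
Proof.
move=> tc dp n12 xA x'A xx' xc x'c; have tcC := two_commonC tc.
have [e_uv c12 CE W0] := tc; have e_vu : e v u by rewrite e_sym.
have c1C : c1 \in common e v u by rewrite commonC CE !inE eqxx.
have c2C : c2 \in common e v u by rewrite commonC CE !inE eqxx orbT.
have c21 : c2 != c1 by rewrite eq_sym.
have noA z : z \in private e u v -> ~~ e z c2.
  move=> zA; apply/negP => zc; move: xx'.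
  by rewrite (no_matching tc xA zA xc zc) (no_matching tc x'A zA x'c zc) eqxx.
have [_ dns _ d2 _] := dp.
have c2B z : e c2 z -> z \notin [:: u; v] -> z \in private e v u.
  move=> cz zN; case: (common_nbr (two_common_swap tc) cz) => [zN'|zE|zA|//].
  - by rewrite zN' in zN.
  - by move: n12; rewrite e_sym -zE cz.
  by move: (noA z zA); rewrite e_sym cz.
have N2 : 2 < #|[set z | e c2 z]| by apply: ltnW.
(* No vertex of A sees c2, so its degree above 3 yields two neighbours b and b' in B. *)
have [b bN bn] := exists_notin (s := [:: u; v]) N2; rewrite inE in bN.
have [b' b'N b'n] := exists_notin (s := [:: u; v; b]) (d2 : 3 < #|[set z | e c2 z]|).
rewrite inE in b'N; have bB := c2B b bN bn.
have b'B : b' \in private e v u.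
  by apply: c2B => //; move: b'n; rewrite !inE !negb_or => /and3P [-> ->].
have bb' : b' != b by move: b'n; rewrite !inE !negb_or => /and3P [].
(* One of b, b' differs from w; calling it b, the path w, z, c1, u, c2, b is forbidden around v. *)
have noB z w : z \in private e u v -> e z c1 -> w \in private e v u -> ~~ e z w.
  move=> zA zc wB; apply/negP => zw.
  have [E|bw] := eqVneq b w.
    subst w; apply: (private_across e_sym e_irr e_free e_vu b'B bB zA c2C c1C bb')
      => //; by rewrite e_sym.
  by apply: (private_across e_sym e_irr e_free e_vu bB wB zA c2C c1C bw)
    => //; rewrite e_sym.
have low z : z \in private e u v -> e z c1 -> deg e z <= 2.
  move=> zA zc; apply: (@deg_le_seq z [:: u; c1]) => w zw.
  case: (private_nbr tc zA zw) => [|wA|wB].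
  - rewrite !inE => /or3P [->|->|/eqP wE]; rewrite ?orbT //.
    by move: (noA z zA); rewrite -wE zw.
  - by move: zw; rewrite (negPf (attached_no_private tc zA zc wA)).
  by move: zw; rewrite (negPf (noB z w zA zc wB)).
have := dns x x'; rewrite !finset.in_setU xA x'A => /(_ isT isT xx').
by rewrite ltnNge (leq_trans (leq_add (low x xA xc) (low x' x'A x'c))).
Qed.

Lemma apart_unique u v c1 c2 x x' : two_common u v c1 c2 ->
  dense_pair u v c1 c2 -> ~~ e c1 c2 -> x \in private e u v ->
  x' \in private e u v -> e x c1 || e x c2 -> e x' c1 || e x' c2 -> x = x'.
Proof.
move=> tc dp n12 xA x'A; have n21 : ~~ e c2 c1 by rewrite e_sym.
case/orP=> xc /orP [] x'c.
- apply/eqP/negPn/negP => xx'; exact: (apart_pair tc dp n12 xA x'A).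
- exact: (no_matching tc).
- by apply/esym; apply: (no_matching tc).
apply/eqP/negPn/negP => xx'.
exact: (apart_pair (two_common_swap tc) (dense_pair_swap dp) n21 xA x'A).
Qed.

(** Degree above 3 gives c1 two neighbours besides u and v; by [apart_unique] each side holds at
    most one, so there is exactly one on each. *)
Lemma apart_nbrs u v c1 c2 : two_common u v c1 c2 ->
  dense_pair u v c1 c2 -> ~~ e c1 c2 -> exists x x',
  [/\ x \in private e u v, x' \in private e v u, e c1 x, e c1 x' & deg e c1 <= 4].
Proof.
move=> tc dp n12; have tcC := two_commonC tc; have dpC := dense_pairC dp.
have [_ _ d1 _ _] := dp.
have split z : e c1 z -> z \notin [:: u; v] ->
    (z \in private e u v) || (z \in private e v u).
  move=> cz zN; case: (common_nbr tc cz) => [zN'|zE|->|->]; rewrite ?orbT //.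
  - by rewrite zN' in zN.
  by move: n12; rewrite -zE cz.
have N2 : 2 < #|[set z | e c1 z]| by apply: ltnW.
have [a aN an] := exists_notin (s := [:: u; v]) N2; rewrite inE in aN.
have [b bN bn] := exists_notin (s := [:: u; v; a]) (d1 : 3 < #|[set z | e c1 z]|).
rewrite inE in bN.
have ba : b != a by move: bn; rewrite !inE !negb_or => /and3P [].
have bn' : b \notin [:: u; v] by move: bn; rewrite !inE !negb_or => /and3P [-> ->].
have att z : e c1 z -> e z c1 || e z c2 by rewrite e_sym => ->.
have [x [x' [xA x'B xc x'c]]] : exists x x', [/\ x \in private e u v,
    x' \in private e v u, e c1 x & e c1 x'].
  case/orP: (split a aN an) => ha; case/orP: (split b bN bn') => hb.
  - by move: ba; rewrite (apart_unique tc dp n12 hb ha (att _ bN) (att _ aN)) eqxx.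
  - by exists a, b.
  - by exists b, a.
  by move: ba; rewrite (apart_unique tcC dpC n12 hb ha (att _ bN) (att _ aN)) eqxx.
exists x, x'; split=> //; apply: (@deg_le_seq c1 [:: u; v; x; x']) => z cz.
case: (common_nbr tc cz) => [|zE|zA|zB].
- by rewrite !inE => /orP [->|->]; rewrite ?orbT.
- by move: n12; rewrite -zE cz.
- by rewrite (apart_unique tc dp n12 zA xA (att _ cz) (att _ xc)) !inE eqxx !orbT.
by rewrite (apart_unique tcC dpC n12 zB x'B (att _ cz) (att _ x'c)) !inE eqxx !orbT.
Qed.

(** With three private vertices, A is {x, z} and B is {x'}. Then z sees at most u and x', while x
    sees at most u, c1, c2 and x': a degree sum of 6. *)
Lemma apart_third u v c1 c2 x x' z : two_common u v c1 c2 ->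
  dense_pair u v c1 c2 -> ~~ e c1 c2 -> x \in private e u v ->
  x' \in private e v u -> e x c1 -> z \in private e u v -> z != x ->
  #|private e u v :|: private e v u| = 3 -> False.
Proof.
move=> tc dp n12 xA x'B xc zA zx U3; have [_ dns _ _ _] := dp.
have xc' : e x c1 || e x c2 by rewrite xc.
have nz c : c \in [:: c1; c2] -> ~~ e z c.
  move=> cE; apply/negP => zc; move: zx.
  suff -> : z = x by rewrite eqxx.
  apply: (apart_unique tc dp n12 zA xA _ xc').
  by move: cE zc; rewrite !inE => /orP [] /eqP -> ->; rewrite ?orbT.
have AE : #|private e u v| = 2 + #|private e u v :\ x :\ z|.
  by rewrite (cardsD1 x) xA (cardsD1 z) !inE zx -in_private zA.
have cU := card_privateU u v; rewrite U3 AE in cU.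
have B0 : 0 < #|private e v u| by apply/card_gt0P; exists x'.
have [A2 B1] : #|private e u v :\ x :\ z| = 0 /\ #|private e v u| = 1.
  exact: room_three cU B0.
have degz : deg e z <= 2.
  rewrite -[2]/(size [:: u] + 1) -B1; apply: deg_le_set => w zw.
  case: (private_nbr tc zA zw) => [|wA|->]; rewrite ?orbT //.
    rewrite inE => /orP [/eqP ->|/nz]; last by rewrite zw.
    by rewrite inE eqxx.
  have wx : w != x.
    apply: contraTneq zw => ->; rewrite e_sym.
    exact: (attached_no_private2 tc xA xc' zA).
  have wz : w != z by rewrite eq_sym (adjacent_neq e_irr zw).
  have : w \in private e u v :\ x :\ z by rewrite !finset.in_setD1 wz wx.
  by move/eqP: A2; rewrite cards_eq0 => /eqP ->; rewrite finset.in_set0.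
have degx : deg e x <= 4.
  rewrite -[4]/(size [:: u; c1; c2] + 1) -B1; apply: deg_le_set => w xw.
  case: (private_nbr tc xA xw) => [->|wA|->]; rewrite ?orbT //.
  by move: xw; rewrite (negPf (attached_no_private2 tc xA xc' wA)).
have := dns z x; rewrite !finset.in_setU xA zA => /(_ isT isT zx).
by rewrite ltnNge (leq_add degz degx : _ <= 6).
Qed.

Lemma apart_contra u v c1 c2 : two_common u v c1 c2 ->
  dense_pair u v c1 c2 -> ~~ e c1 c2 -> False.
Proof.
move=> tc dp n12; have n21 : ~~ e c2 c1 by rewrite e_sym.
have [x [x' [xA x'B xc x'c d1]]] := apart_nbrs tc dp n12.
have [_ [_ [_ _ _ _ d2]]] := apart_nbrs (two_common_swap tc) (dense_pair_swap dp) n21.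
have [n7 dns _ _ [n8 _]] := dp.
have nE : n = 4 + #|private e u v :|: private e v u|.
  by rewrite (card_privateU u v) addnA; exact: (two_common_card tc).
have U3 := room_seven n7 nE n8 d1 d2.
have U2 : 2 < #|private e u v :|: private e v u| by rewrite U3.
have [z + zN] := exists_notin (s := [:: x; x']) U2.
move: zN; rewrite !inE negb_or => /andP [zx zx'].
rewrite e_sym in xc; rewrite e_sym in x'c.
rewrite -!in_private => /orP [zA|zB].
  exact: (apart_third tc dp n12 xA x'B xc zA zx U3).
apply: (apart_third (two_commonC tc) (dense_pairC dp) n12 x'B xA x'c zB zx').
by rewrite finset.setUC.
Qed.

Lemma two_common_contra u v c1 c2 : two_common u v c1 c2 ->
  dense_pair u v c1 c2 -> False.
Proof.
move=> tc dp; have [e12|n12] := boolP (e c1 c2).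
  exact: (adjacent_contra tc dp).
exact: (apart_contra tc dp).
Qed.

End TwoCommon.

(** * Degree bounds from the weights of two common neighbours *)

Section TwoContra.
Context (R : realType) (n : nat).
Variables (e : rel 'I_n) (q : R) (y : 'I_n -> R) (u v : 'I_n).
Hypotheses (e_sym : symmetric e) (e_irr : irreflexive e).
Hypothesis e_free : ~ has_trebly_chorded_cycle_at_vertex e.
Hypothesis q_large : large_index n q.
Hypothesis uv_heavy : heavy_edge e q y u v.

Local Notation C := (common e u v).
Local Notation A := (private e u v).
Local Notation B := (private e v u).
Local Notation W := (remote e u v).
Local Notation S := (\sum_(x in C) y x).

Let qn : n%:R + 173 / 100 <= q. Proof. by case: q_large. Qed.
Let e_uv : e u v. Proof. by case: uv_heavy. Qed.
Let vu_heavy := heavy_edgeC e_sym uv_heavy.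

Hypotheses (C2 : #|C| = 2%N) (n7 : (7 <= n)%N).

Lemma heavy_dense_pair c1 c2 : two_common e u v c1 c2 -> dense_pair e u v c1 c2.
Proof.
case=> _ c12 CE W0.
have c1C : c1 \in C by rewrite CE !inE eqxx.
have c2C : c2 \in C by rewrite CE !inE eqxx orbT.
have SE : S = y c1 + y c2 by rewrite CE big_setU1 ?big_set1 //= !inE.
have [h1 h1'] := heavy_common_le uv_heavy c1C.
have [h2 h2'] := heavy_common_le uv_heavy c2C.
have hS := heavy_sum e_sym e_irr uv_heavy; rewrite W0 cards0 SE in hS.
have hle := heavy_sum_le e_sym e_irr uv_heavy; rewrite W0 cards0 SE in hle.
have y_uv : y u + y v = 1 by case: uv_heavy.
have lA x : x \in A -> 0 <= y v - y x by apply: (heavy_loss_private uv_heavy).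
have lB x : x \in B -> 0 <= y u - y x by apply: (heavy_loss_private vu_heavy).
have N7 : 7 <= n%:R :> R by rewrite (ler_nat R 7).
have q_ge := qn.
have sum1 (D : {set 'I_n}) (f : 'I_n -> R) x : (forall z, z \in D -> 0 <= f z) ->
    x \in D -> f x <= \sum_(z in D) f z.
  move=> f0 xD; rewrite (bigD1 x) //= lerDl sumr_ge0 // => z /andP [zD _].
  exact: f0.
have sum2 (D : {set 'I_n}) (f : 'I_n -> R) x x' : (forall z, z \in D -> 0 <= f z) ->
    x \in D -> x' \in D -> x != x' -> f x + f x' <= \sum_(z in D) f z.
  move=> f0 xD x'D xx'; rewrite (bigD1 x) //= lerD2l (bigD1 x') /=; last first.
    by rewrite x'D eq_sym.
  rewrite lerDl sumr_ge0 // => z /andP [/andP [zD _] _].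
  exact: f0.
have sA : 0 <= \sum_(z in A) (y v - y z) by apply: sumr_ge0 => z; apply: lA.
have sB : 0 <= \sum_(z in B) (y u - y z) by apply: sumr_ge0 => z; apply: lB.
have deg_gt x k (r : R) : q * y x <= (deg e x)%:R -> r <= y x -> 0 <= r ->
    k%:R < (n%:R + 173 / 100) * r -> (k < deg e x)%N.
  move=> qx rx r0 kr; rewrite -(ltr_nat R); apply: lt_le_trans kr _.
  apply: le_trans qx; apply: ler_pM => //; lra.
have deg2_gt x x' k (r : R) : r <= y x + y x' -> 0 <= r ->
    k%:R < (n%:R + 173 / 100) * r -> (k < deg e x + deg e x')%N.
  move=> rx r0 kr; rewrite -(ltr_nat R) natrD; apply: lt_le_trans kr _.
  apply: le_trans (lerD (heavy_le_deg uv_heavy x) (heavy_le_deg uv_heavy x')).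
  by rewrite -mulrDr; apply: ler_pM => //; lra.
split=> //.
- move=> x x'; rewrite !finset.in_setU => xAB x'AB xx'.
  (* Without losses the two entries sum to at least S, because y_u and y_v are each at least S / 2
     and sum to 1 >= S. The losses total at most 2 S - 1.73, so at least 1.73 - S >= 0.73 remains,
     and 8.73 * 0.73 > 6. *)
  apply: (@deg2_gt x x' 6 (73 / 100)); [|lra|lra].
  case/orP: xAB => hx; case/orP: x'AB => hx'.
  + by have := sum2 _ _ _ _ lA hx hx' xx'; lra.
  + by have := sum1 _ _ _ lA hx; have := sum1 _ _ _ lB hx'; lra.
  + by have := sum1 _ _ _ lB hx; have := sum1 _ _ _ lA hx'; lra.
  by have := sum2 _ _ _ _ lB hx hx' xx'; lra.
(* From y_c1 + y_c2 >= 0.865 and both at most 1/2, each is at least 0.365; and 8.73 * 0.365 > 3. *)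
- by apply: (@deg_gt c1 3 (365 / 1000)); [apply: heavy_le_deg uv_heavy _|lra|lra|lra].
- by apply: (@deg_gt c2 3 (365 / 1000)); [apply: heavy_le_deg uv_heavy _|lra|lra|lra].
(* Here 9.73 * 0.865 > 8 for n >= 8 and 11.73 * 0.865 > 10 for n >= 10. *)
split=> big.
  have N8 : 8 <= n%:R :> R by rewrite (ler_nat R 8).
  by apply: (@deg2_gt c1 c2 8 (865 / 1000)); lra.
have N10 : 10 <= n%:R :> R by rewrite (ler_nat R 10).
by apply: (@deg2_gt c1 c2 10 (865 / 1000)); lra.
Qed.

Lemma heavy_two_contra : False.
Proof.
have /cards2P [c1 [c2 [c12 CE]]] : #|C| == 2%N by rewrite C2.
have W0 : W = finset.set0.
  apply/eqP; rewrite -cards_eq0 -leqn0.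
  by have := common_large e_sym e_irr q_large uv_heavy; rewrite C2 addn2 !ltnS.
have tc : two_common e u v c1 c2 by split.
exact: (two_common_contra e_sym e_irr e_free tc (heavy_dense_pair tc)).
Qed.

End TwoContra.

Section LargeCommon.
Context (R : realType) (n : nat).
Variables (e : rel 'I_n) (q : R) (y : 'I_n -> R) (u v : 'I_n).
Hypotheses (e_sym : symmetric e) (e_irr : irreflexive e).
Hypothesis e_free : ~ has_trebly_chorded_cycle_at_vertex e.
Hypothesis q_large : large_index n q.
Hypothesis uv_heavy : heavy_edge e q y u v.

Local Notation C := (common e u v).

(** If C is independent, either some remote vertex has four neighbours in C, which is [hub_contra],
    or none does, which is [indep_contra]. *)
Lemma heavy_common_edge : (2 < #|C|)%N ->
  exists c1 c2, [/\ c1 \in C, c2 \in C & e c1 c2].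
Proof.
move=> c3; apply: contrapT => noE.
have e_uv : e u v by case: uv_heavy.
have indep : common_indep e u v.
  by move=> c1 c2 h1 h2; apply/negP => e12; apply: noE; exists c1, c2.
have [[w [wW w4]]|no] := pselect (exists w, w \in remote e u v /\
    (3 < #|common_nbrs e u v w|)%N).
  exact: (hub_contra e_sym e_irr e_free q_large uv_heavy indep wW w4).
apply: (indep_contra e_sym e_irr e_free q_large uv_heavy c3 indep) => w wW.
by rewrite leqNgt; apply/negP => w4; apply: no; exists w.
Qed.

End LargeCommon.

(** * The extremal graphs *)

Lemma perm_extending (n : nat) (x0 : 'I_n) (l : seq 'I_n) : uniq l ->
  exists s : {perm 'I_n}, forall i : 'I_n, (i < size l)%N -> s i = nth x0 l i.
Proof.
move=> ul; pose L := l ++ [seq x <- enum 'I_n | x \notin l].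
have uL : uniq L.
  rewrite cat_uniq ul filter_uniq ?enum_uniq // andbT /=.
  by apply/hasPn => x; rewrite mem_filter => /andP [].
have szL : size L = n.
  rewrite -[RHS](size_enum_ord n); apply: perm_size.
  apply: uniq_perm; rewrite // ?enum_uniq // => x.
  by rewrite mem_cat mem_filter mem_enum andbT orbN.
have inj : injective (fun i : 'I_n => nth x0 L i).
  move=> i j /eqP; rewrite nth_uniq ?szL ?ltn_ord // => /eqP.
  exact: val_inj.
by exists (perm inj) => i il; rewrite permE nth_cat il.
Qed.

Lemma perm_eq_nth (n : nat) (x0 : 'I_n) (l : seq 'I_n) (s : {perm 'I_n}) k x :
  (forall i : 'I_n, (i < size l)%N -> s i = nth x0 l i) -> (k < size l)%N ->
  (k < n)%N -> (s x == nth x0 l k) = ((x : nat) == k).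
Proof. by move=> sl kl kn; rewrite -(sl (Ordinal kn)) // (inj_eq perm_inj). Qed.

Lemma isomorphic_K11n2_plus (n : nat) (e : rel 'I_n) u v c1 c2 : (4 <= n)%N ->
  uniq [:: u; v; c1; c2] ->
  (forall z t, e z t = (z != t) && [|| z == u, z == v, t == u, t == v,
     (z == c1) && (t == c2) | (z == c2) && (t == c1)]) ->
  isomorphic e (@K11n2_plus n).
Proof.
move=> n4 us eE; have [s sl] := perm_extending u us; exists s => x y.
have sE k z : (k < 4)%N -> (s z == nth u [:: u; v; c1; c2] k) = ((z : nat) == k).
  by move=> k4; apply: perm_eq_nth sl _ _; rewrite // (leq_trans k4).
have s0 z := sE 0%N z isT; have s1 z := sE 1%N z isT.
have s2 z := sE 2%N z isT; have s3 z := sE 3%N z isT.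
rewrite /= in s0 s1 s2 s3.
rewrite eE !s0 !s1 !s2 !s3 (inj_eq perm_inj) /K11n2_plus.
have lt2 (z : 'I_n) : (z < 2)%N = (z == 0%N :> nat) || (z == 1%N :> nat).
  by case: (nat_of_ord z) => [|[|k]].
by rewrite !lt2 -!orbA.
Qed.

Lemma isomorphic_K1_join (e : rel 'I_6) h a b c d p : uniq [:: h; a; b; c; d; p] ->
  (forall z t, e z t = (z != t) && [|| z == h, t == h | (z != p) && (t != p)]) ->
  isomorphic e (@K1_join_K4_K1 6).
Proof.
move=> us eE; have [s sl] := perm_extending h us; exists s => x y.
have sE k z : (k < 6)%N -> (s z == nth h [:: h; a; b; c; d; p] k) = ((z : nat) == k).
  by move=> k6; apply: perm_eq_nth sl _ _.
have s0 z := sE 0%N z isT; have s5 z := sE 5%N z isT; rewrite /= in s0 s5.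
rewrite eE !s0 !s5 (inj_eq perm_inj) /K1_join_K4_K1; congr (_ && _).
have lt5 (z : 'I_6) : ((z : nat) == 0%N) || (1 <= z <= 4)%N = (z != 5%N :> nat).
  by case: z => -[|[|[|[|[|[|]]]]]].
rewrite -!lt5; case: (_ == 0%N) => //=; case: (_ == 0%N) => //=.
by rewrite -!andbA.
Qed.

(** * Identification of the extremal graph for n >= 7 *)

Section Conclusion.
Context (R : realType) (n : nat).
Variables (e : rel 'I_n) (q : R) (y : 'I_n -> R) (u v : 'I_n).
Hypotheses (e_sym : symmetric e) (e_irr : irreflexive e).
Hypothesis e_free : ~ has_trebly_chorded_cycle_at_vertex e.
Hypothesis q_large : large_index n q.
Hypothesis uv_heavy : heavy_edge e q y u v.

Local Notation C := (common e u v).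

Let e_uv : e u v. Proof. by case: uv_heavy. Qed.

Lemma heavy_seven : (7 <= n)%N -> isomorphic e (@K11n2_plus n).
Proof.
move=> n7; have CW := common_large e_sym e_irr q_large uv_heavy.
have C2 : (1 < #|C|)%N by apply: leq_trans CW; rewrite leq_addl.
have [C2'|C3] := leqP #|C| 2.
  have CE : #|C| = 2%N by apply/eqP; rewrite eqn_leq C2'.
  by case: (heavy_two_contra e_sym e_irr e_free q_large uv_heavy CE n7).
have [c1 [c2 [h1 h2 e12]]] := heavy_common_edge e_sym e_irr e_free q_large uv_heavy C3.
have [C3'|C4] := leqP #|C| 3.
  have CE : #|C| = 3%N by apply/eqP; rewrite eqn_leq C3'.
  by case: (three_common_contra e_sym e_irr e_free q_large uv_heavy CE h1 h2 e12 n7).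
have [/eqP A0 /eqP B0 /eqP W0] :=
  single_edge_cells e_sym e_irr e_free q_large uv_heavy C4 h1 h2 e12.
rewrite !cards_eq0 in A0 B0 W0.
have cells z : [|| z == u, z == v | z \in C].
  have := finset.in_set0 z; rewrite -{1}(eqP A0) in_private.
  have := finset.in_set0 z; rewrite -{1}(eqP B0) in_private.
  have := finset.in_set0 z; rewrite -{1}(eqP W0) in_remote in_common.
  by case: (z == u); case: (z == v); case: (e u z); case: (e v z).
have uC z : z \in C -> [/\ e u z, e v z, z != u & z != v].
  rewrite in_common => /andP [uz vz]; split=> //; rewrite eq_sym.
    exact: (adjacent_neq e_irr uz).
  exact: (adjacent_neq e_irr vz).
have [u1 v1 n1u n1v] := uC _ h1; have [u2 v2 n2u n2v] := uC _ h2.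
have uv := adjacent_neq e_irr e_uv; have c12 := adjacent_neq e_irr e12.
apply: (@isomorphic_K11n2_plus n e u v c1 c2 _ _).
- by apply: leq_trans n7.
- by rewrite /= !inE !negb_or uv c12 ![_ == c1]eq_sym ![_ == c2]eq_sym n1u n1v n2u n2v.
move=> z t; case/or3P: (cells z) => [/eqP ->|/eqP ->|zC].
- rewrite eqxx /= andbT; case/or3P: (cells t) => [/eqP ->|/eqP ->|/uC [-> _ tu _]].
  + by rewrite eqxx e_irr.
  + by rewrite uv.
  by rewrite eq_sym tu.
- rewrite eqxx orbT andbT; case/or3P: (cells t) => [/eqP ->|/eqP ->|/uC [_ -> _ tv]].
  + by rewrite e_sym e_uv eq_sym uv.
  + by rewrite eqxx e_irr.
  by rewrite eq_sym tv.
have [uz vz zu zv] := uC z zC.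
case/or3P: (cells t) => [/eqP ->|/eqP ->|tC].
- by rewrite e_sym uz zu eqxx !orbT.
- by rewrite e_sym vz zv eqxx !orbT.
have [_ _ tu tv] := uC t tC.
rewrite (common_edgeE e_sym e_irr e_free uv_heavy C4 h1 h2 e12 zC tC).
rewrite (negPf zu) (negPf zv) (negPf tu) (negPf tv) /=.
have [->|//] := eqVneq z t.
by have [->|_] := eqVneq t c1; rewrite ?(negPf c12) ?andbF.
Qed.

End Conclusion.

Lemma large_index_six (R : realType) (q : R) : 827 / 100 <= q -> large_index 6 q.
Proof.
move=> q8; split=> //; first by lra.
have h : 8 / (q - 4) <= 2 by rewrite ler_pdivrMr; lra.
have : (227 / 100) * (627 / 100) <= (q - 6) * (q - 2) by apply: ler_pM; lra.
lra.
Qed.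

Lemma six_cells a b r : (6 = 2 + a + b + 3 + r)%N ->
  [\/ [/\ a = 1, b = 0 & r = 0], [/\ a = 0, b = 1 & r = 0] |
      [/\ a = 0, b = 0 & r = 1]]%N.
Proof.
by case: a => [|[|a]]; case: b => [|[|b]]; case: r => [|[|r]] h;
  first [exfalso; lia | by constructor 1 | by constructor 2 | by constructor 3].
Qed.

(** 2.27 * 6.27 is about 14.23, against 14; this is where 8.27 cannot be relaxed by much. *)
Lemma path_gap_six (R : realType) (q s : R) : 827 / 100 <= q ->
  q - 6 <= 2 * s -> (q - 2) * s <= 7 -> False.
Proof.
move=> q8 h1 h2.
have h3 : 227 / 100 * (q - 2) <= (q - 6) * (q - 2) by rewrite ler_wpM2r; lra.
have h4 : (q - 6) * (q - 2) <= 2 * s * (q - 2) by rewrite ler_wpM2r; lra.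
lra.
Qed.

(** * Graphs of order six *)

Section SixVertices.
Context (R : realType).
Variables (e : rel 'I_6) (q : R) (y : 'I_6 -> R).
Hypotheses (e_sym : symmetric e) (e_irr : irreflexive e).
Hypothesis e_free : ~ has_trebly_chorded_cycle_at_vertex e.
Hypothesis q8 : 827 / 100 <= q.

Let q_large : large_index 6 q. Proof. exact: large_index_six. Qed.

(** The vertex u is the dominating one, x is pendant at u, and v together with C forms the K_4. *)
Lemma pendant_isomorphic u v c1 c2 c3 x : e u v ->
  uniq [:: c1; c2; c3] ->
  common e u v = [set z in [:: c1; c2; c3]] -> private e u v = [set x] ->
  private e v u = finset.set0 -> remote e u v = finset.set0 ->
  e c1 c2 -> e c1 c3 -> e c2 c3 ->
  (forall z, z \in common e u v -> e z x = false) ->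
  isomorphic e (@K1_join_K4_K1 6).
Proof.
move=> e_uv uc CE AE B0 W0 e12 e13 e23 Cx.
have e_vu : e v u by rewrite e_sym.
have xA : x \in private e u v by rewrite AE inE.
have [ux vx xv] : [/\ e u x, e v x = false & x != v].
  by move: xA; rewrite in_private => /and3P [-> /negPf ->].
have xu : x != u by rewrite eq_sym (adjacent_neq e_irr ux).
have uv := adjacent_neq e_irr e_uv.
have cells z : [|| z == u, z == v, z == x | z \in common e u v].
  have := finset.in_set0 z; rewrite -{1}B0 in_private.
  have := finset.in_set0 z; rewrite -{1}W0 in_remote in_common.
  have := finset.in_set1 z x; rewrite -AE in_private => <-.
  by case: (z == u); case: (z == v); case: (e u z); case: (e v z).
have CP z : z \in common e u v -> [/\ e u z, e v z, z != u, z != v & z != x].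
  move=> zC; have := zC; rewrite in_common => /andP [uz vz]; split=> //.
  - by rewrite eq_sym (adjacent_neq e_irr uz).
  - by rewrite eq_sym (adjacent_neq e_irr vz).
  by apply: contraTneq vz => ->; rewrite vx.
have CC z t : z \in common e u v -> t \in common e u v -> z != t -> e z t.
  rewrite CE !inE => /or3P [] /eqP -> /or3P [] /eqP -> //; rewrite ?eqxx //;
  by rewrite e_sym.
have cC c : c \in [:: c1; c2; c3] -> c \in common e u v by move=> h; rewrite CE inE.
have c1C : c1 \in common e u v by apply: cC; rewrite !inE eqxx.
have c2C : c2 \in common e u v by apply: cC; rewrite !inE eqxx orbT.
have c3C : c3 \in common e u v by apply: cC; rewrite !inE eqxx !orbT.
have [_ _ u1 v1 x1] := CP c1 c1C; have [_ _ u2 v2 x2] := CP c2 c2C.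
have [_ _ u3 v3 x3] := CP c3 c3C.
apply: (@isomorphic_K1_join e u v c1 c2 c3 x).
  move: uc; rewrite /= !inE !negb_or !andbT => /andP [/andP [-> ->] ->].
  by rewrite uv ![u == _]eq_sym ![v == _]eq_sym u1 u2 u3 v1 v2 v3 x1 x2 x3 xu xv.
move=> z t; case/or4P: (cells z) => [/eqP ->|/eqP ->|/eqP ->|zC];
  case/or4P: (cells t) => [/eqP ->|/eqP ->|/eqP ->|tC];
  rewrite ?e_irr ?eqxx ?andbF //=.
- by rewrite e_uv uv ?orbT.
- by rewrite [u == x]eq_sym xu ux.
- by have [-> _ tu _ _] := CP t tC; rewrite [u == t]eq_sym tu.
- by rewrite e_vu [v == u]eq_sym uv orbT.
- by rewrite vx [v == u]eq_sym (negPf uv) (negPf xu) andbF.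
- have [_ -> tu tv tx] := CP t tC; rewrite [v == t]eq_sym tv [v == x]eq_sym xv tx.
  by rewrite !orbT.
- by rewrite e_sym ux xu orbT.
- by rewrite e_sym vx [v == u]eq_sym (negPf uv) (negPf xu) andbF.
- have [_ _ tu _ _] := CP t tC.
  by rewrite e_sym Cx // (negPf xu) (negPf tu) andbF.
- by have [uz _ zu _ _] := CP z zC; rewrite e_sym uz zu orbT.
- have [_ vz zu zv zx] := CP z zC.
  by rewrite e_sym vz zv zx [v == x]eq_sym xv !orbT.
- have [_ _ zu _ _] := CP z zC.
  by rewrite Cx // (negPf xu) (negPf zu) andbF.
have [_ _ zu _ zx] := CP z zC; have [_ _ tu _ tx] := CP t tC.
rewrite zx tx !orbT andbT; have [->|zt] := eqVneq z t; first exact: e_irr.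
exact: CC.
Qed.

Lemma heavy_six u v : heavy_edge e q y u v -> isomorphic e (@K1_join_K4_K1 6).
Proof.
move=> uv_heavy; have e_uv : e u v by case: uv_heavy.
have vu_heavy := heavy_edgeC e_sym uv_heavy.
have y0 z : 0 <= y z by case: uv_heavy.
have hs := heavy_sum_le e_sym e_irr uv_heavy.
have hc := common_sum_le_half uv_heavy.
(* Since q - 6 >= 2.27 exceeds 2, the gap is one larger than in [common_large]. *)
have CW : (#|remote e u v| + 2 < #|common e u v|)%N.
  rewrite ltnNge; apply/negP; rewrite -(ler_nat R) natrD => h.
  by move: hs hc q8 h; lra.
have C3 : (2 < #|common e u v|)%N by apply: leq_trans CW; rewrite ltnS leq_addl.
have [c1 [c2 [h1 h2 e12]]] := heavy_common_edge e_sym e_irr e_free q_large uv_heavy C3.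
have S0 : 0 <= \sum_(x in common e u v) y x by apply: sumr_ge0.
(* Four common neighbours would make the graph K_{1,1,4}^+; then S < 0.79, whereas 2 S >= 2.27. *)
have [C3'|C4] := leqP #|common e u v| 3; last first.
  have [A0 B0 W0] := single_edge_cells e_sym e_irr e_free q_large uv_heavy C4 h1 h2 e12.
  have hN := cells_natr e_sym e_irr uv_heavy; rewrite A0 B0 W0 in hN hs.
  have hY := sum_edge_le e_sym e_irr e_free uv_heavy C4 h1 h2 e12; rewrite W0 in hY.
  have hS := heavy_common_sum e_sym e_irr uv_heavy; exfalso; move: hS.
  rewrite (sum_weight_edge e_sym e_irr e_free uv_heavy C4 h1 h2 e12).
  have [-> ->] := common_edge_sum_private0 e_sym e_irr e_free uv_heavy C3 h1 h2 e12.
  move/eqP: W0; rewrite cards_eq0 => /eqP ->; rewrite big_set0.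
  have Y0 : 0 <= y c1 + y c2 by rewrite addr_ge0.
  move: hN hs hY S0 Y0 q8; move: (y c1 + y c2) (\sum_(x in _) _) q #|_|%:R.
  move=> Y s p c hN hs hY s0 Y0 p8 hS.
  have h3 : 427 / 100 * Y <= (p - 4) * Y by rewrite ler_wpM2r //; lra.
  have h4 : 627 / 100 * s <= (p - 2) * s by rewrite ler_wpM2r //; lra.
  by lra.
have CE : #|common e u v| = 3%N by apply/eqP; rewrite eqn_leq C3'.
have [c3 [c3C uc bound]] :=
  three_common_bound e_sym e_irr e_free q_large uv_heavy CE h1 h2 e12.
have W0 : #|remote e u v| = 0%N by apply/eqP; rewrite -leqn0; move: CW; rewrite CE addn2 !ltnS.
have tri : e c1 c3 && e c2 c3.
  move: bound; case: ifP => // _ /andP [_ hb]; rewrite W0 in hs hb; exfalso.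
  rewrite mulr0 addr0 in hb; rewrite addr0 in hs.
  exact: path_gap_six q8 hs hb.
have /andP [e13 e23] := tri.
have CS : common e u v = [set z in [:: c1; c2; c3]].
  apply/esym/eqP; rewrite eqEcard CE cardsE (card_uniqP uc) leqnn andbT.
  by apply/fintype.subsetP => z; rewrite inE !(in_cons, in_nil) orbF =>
    /or3P [] /eqP ->.
have priv0 x : x \in private e u v :|: private e v u ->
    forall z, z \in common e u v -> e z x = false.
  move=> xAB z zC.
  have := common_edge_private0 e_sym e_irr e_free uv_heavy C3 h1 h2 e12 xAB.
  move=> /eqP; rewrite cards_eq0 => /eqP/setP/(_ z).
  by rewrite in_common_nbrs zC finset.in_set0.
have WE : remote e u v = finset.set0 by apply/eqP; rewrite -cards_eq0 W0.
have := card_cells e_sym e_irr e_uv; rewrite CE.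
case/six_cells=> -[A1 B1 W1].
- have /cards1P [x AE] : #|private e u v| == 1%N by rewrite A1.
  have BE : private e v u = finset.set0 by apply/eqP; rewrite -cards_eq0 B1.
  apply: (pendant_isomorphic e_uv uc CS AE BE WE) => //.
  by apply: priv0; rewrite AE finset.in_setU finset.in_set1 eqxx.
- have /cards1P [x BE] : #|private e v u| == 1%N by rewrite B1.
  have AE : private e u v = finset.set0 by apply/eqP; rewrite -cards_eq0 A1.
  have e_vu : e v u by rewrite e_sym.
  have CS' : common e v u = [set z in [:: c1; c2; c3]] by rewrite commonC.
  have WE' : remote e v u = finset.set0 by rewrite remoteC.
  apply: (pendant_isomorphic e_vu uc CS' BE AE WE') => // z.
  rewrite commonC; apply: priv0.
  by rewrite BE finset.in_setU finset.in_set1 eqxx orbT.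
by rewrite W0 in W1.
Qed.

End SixVertices.

(** * Existence of a heavy edge, and indices of the extremal graphs *)

Lemma exists_heavy_edge (R : realType) n (e : rel 'I_n) (q : R) y :
  symmetric e -> no_isolated e -> subsolution e q y ->
  exists u v y', heavy_edge e q y' u v.
Proof.
move=> e_sym noiso [y0 [w yw] ysub]; have [x wx] := noiso w.
pose P := [pred p : 'I_n * 'I_n | e p.1 p.2].
pose F (p : 'I_n * 'I_n) := y p.1 + y p.2.
have P0 : P (w, x) by [].
case: (@arg_maxP _ R _ (w, x) P F P0) => -[u v] /= euv umax.
(* A vertex with a positive entry has a neighbour, so the maximal edge weight is positive and may be
   scaled to 1. *)
have z0 : 0 < F (u, v).
  by apply: lt_le_trans (umax (w, x) wx); rewrite /F /= ltr_wpDr.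
exists u, v, (fun z => y z / F (u, v)); split=> //.
- by move=> z; rewrite divr_ge0 // ltW.
- move=> z; rewrite mulrA; apply: le_trans (_ : (\sum_(x0 | e z x0) (y z + y x0)) / F (u, v) <= _).
    by rewrite ler_pM2r ?invr_gt0.
  by rewrite mulr_suml ler_sum // => t _; rewrite mulrDl.
- by rewrite -mulrDl divff // gt_eqF.
by move=> a b eab; rewrite -mulrDl ler_pdivrMr // mul1r; apply: (umax (a, b)).
Qed.

Lemma K11n2_plus_sym n : symmetric (@K11n2_plus n).
Proof.
move=> i j; rewrite /K11n2_plus eq_sym; congr (_ && _).
rewrite orbCA; congr (_ || (_ || _)).
by rewrite orbC [in X in X || _]andbC [in X in _ || X]andbC.
Qed.

Lemma K1_join_sym n : symmetric (@K1_join_K4_K1 n).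
Proof.
move=> i j; rewrite /K1_join_K4_K1 eq_sym; congr (_ && _).
rewrite orbCA; congr (_ || (_ || _)).
by rewrite [LHS]andbA andbC -!andbA.
Qed.

Lemma sum_ord_split4 (R : realType) n (G : nat -> R) : (4 <= n)%N ->
  \sum_(x < n) G x = G 0%N + G 1%N + G 2%N + G 3%N + \sum_(4 <= k < n) G k.
Proof.
move=> n4; rewrite -(big_mkord xpredT) /=.
have lt_n k : (k < 4)%N -> (k < n)%N by move=> k4; apply: leq_trans n4.
rewrite (big_ltn (lt_n 0%N isT)) (big_ltn (lt_n 1%N isT)) (big_ltn (lt_n 2%N isT)).
by rewrite (big_ltn (lt_n 3%N isT)) !addrA.
Qed.

Section ExtremalEigenvalues.
Context (R : realType).

Lemma K11n2_plus_eigenvalue n (r : R) : (4 <= n)%N -> 4 < r ->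
  (r - n%:R) * (r - 2) * (r - 4) = 2 * (n%:R - 4) * (r - 4) + 4 * (r - 2) ->
  eigenvalue (signless_lap R (@K11n2_plus n)) r.
Proof.
move=> n4 r4 rE.
(* The eigenvector is constant on the two dominating vertices, the ends of the added edge, and the
   rest. With value 1 on the first class, the equations on the other two classes determine their
   values; the equation at a dominating vertex is then the cubic with denominators restored
   ([abE]). *)
pose Y (k : nat) : R := if (k < 2)%N then 1 else if (k < 4)%N then 2 / (r - 4)
  else 2 / (r - 2).
have r4' : r - 4 != 0 by rewrite gt_eqF // subr_gt0.
have r2' : r - 2 != 0 by rewrite gt_eqF // subr_gt0; lra.
apply: (@positive_solution_eigenvalue R n _ r (fun i : 'I_n => Y i)).
- exact: K11n2_plus_sym.
- by exists (Ordinal (leq_trans (isT : (0 < 4)%N) n4)); rewrite /Y /= oner_neq0.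
move=> w; rewrite big_mkcond /=.
pose E (i j : nat) := (i != j) && [|| (i < 2)%N, (j < 2)%N,
  (i == 2%N) && (j == 3%N) | (i == 3%N) && (j == 2%N)].
rewrite (sum_ord_split4 (fun k => if E w k then Y w + Y k else 0) n4).
have ge4 k : (4 <= k)%N -> (k < 2)%N = false /\ (k < 4)%N = false.
  by case: k => [|[|[|[|k]]]].
have tail1 (i : nat) : (i < 2)%N ->
    \sum_(4 <= k < n) (if E i k then Y i + Y k else 0) =
    (n%:R - 4) * (1 + 2 / (r - 2)).
  move=> i2; rewrite (eq_big_nat _ _ (F2 := fun=> 1 + 2 / (r - 2))).
    by rewrite big_const_nat iter_addr addr0 -[_ *+ (n - 4)]mulr_natl natrB.
  move=> k /andP [k4 _]; rewrite /E /Y i2 /=.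
  have [-> ->] := ge4 k k4; rewrite andbT neq_ltn (leq_trans i2) //.
  exact: leq_trans k4.
have tail2 (i : nat) : (2 <= i)%N ->
    \sum_(4 <= k < n) (if E i k then Y i + Y k else 0) = 0.
  move=> i2; rewrite big_nat_cond big1 // => k /andP [/andP [k4 _] _].
  have [k2 _] := ge4 k k4; rewrite /E k2 ltnNge i2 /=.
  by case: k k4 {k2} => [|[|[|[|k]]]] //= _; rewrite !andbF.
have aE : 2 / (r - 4) * (r - 4) = 2 by rewrite divfK.
have bE : 2 / (r - 2) * (r - 2) = 2 by rewrite divfK.
have abE : r = n%:R + 2 * (2 / (r - 4)) + (n%:R - 4) * (2 / (r - 2)).
  have : r - n%:R = (2 * (n%:R - 4) * (r - 4) + 4 * (r - 2)) / ((r - 2) * (r - 4)).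
    by rewrite -rE; field; rewrite r2' r4'.
  by move/eqP; rewrite subr_eq => /eqP {1}->; field; rewrite r2' r4'.
have [w2|w2] := ltnP w 2.
  rewrite tail1 //; case: (nat_of_ord w) w2 => [|[|//]] _; rewrite /E /Y /=; lra.
rewrite tail2 // /E /Y.
by case: (nat_of_ord w) w2 => [|[|[|[|k]]]] //= _; rewrite ?andbF /=; lra.
Qed.

Lemma K1_join_eigenvalue (r : R) : 7 < r ->
  (r - 5) * (r - 7) * (r - 1) = 4 * (r - 1) + (r - 7) ->
  eigenvalue (signless_lap R (@K1_join_K4_K1 6)) r.
Proof.
move=> r7 rE.
(* Again one value per class: the dominating vertex, the K_4, and the pendant vertex. *)
pose Y (k : nat) : R := if k == 0%N then 1 else if (k < 5)%N then 1 / (r - 7)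
  else 1 / (r - 1).
have r7' : r - 7 != 0 by rewrite gt_eqF // subr_gt0.
have r1' : r - 1 != 0 by rewrite gt_eqF // subr_gt0; lra.
apply: (@positive_solution_eigenvalue R 6 _ r (fun i : 'I_6 => Y i)).
- exact: K1_join_sym.
- by exists ord0; rewrite /Y /= oner_neq0.
have aE : 1 / (r - 7) * (r - 7) = 1 by rewrite divfK.
have bE : 1 / (r - 1) * (r - 1) = 1 by rewrite divfK.
have abE : r = 5 + 4 * (1 / (r - 7)) + 1 / (r - 1).
  have : r - 5 = (4 * (r - 1) + (r - 7)) / ((r - 7) * (r - 1)).
    by rewrite -rE; field; rewrite r1' r7'.
  by move/eqP; rewrite subr_eq => /eqP {1}->; field; rewrite r1' r7'.
move=> w; rewrite big_mkcond /= !big_ord_recl big_ord0 /K1_join_K4_K1 /=.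
by case: w => -[|[|[|[|[|[|k]]]]]] //= ?; rewrite /Y /=; lra.
Qed.

Lemma K11n2_plus_large n q : (7 <= n)%N -> q_index R (@K11n2_plus n) <= q ->
  large_index n q.
Proof.
move=> n7 hq; have N7 : 7 <= n%:R :> R by rewrite (ler_nat R 7).
pose N : R := n%:R.
pose p : {poly R} := ('X - N%:P) * ('X - 2%:P) * ('X - 4%:P)
  - (2 * (N - 4))%:P * ('X - 4%:P) - 4%:P * ('X - 2%:P).
have pE x : p.[x] = (x - N) * (x - 2) * (x - 4) - 2 * (N - 4) * (x - 4) - 4 * (x - 2).
  by rewrite /p !hornerE.
have ab : N + 173 / 100 <= N + 2 by lra.
have sign : p.[N + 173 / 100] <= 0 <= p.[N + 2].
  (* At N + 1.73 the cubic becomes a concave quadratic in N with vertex near 7.68 and maximum about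
     -0.1 there, which is why 1.73 works for every n. *)
  have sq := sqr_ge0 (N - 768 / 100); rewrite expr2 in sq.
  by rewrite !pE; apply/andP; rewrite -/N in N7; split; lra.
have [r /andP [r1 r2] rp] := poly_ivt ab sign.
have {}rp : (r - N) * (r - 2) * (r - 4) = 2 * (N - 4) * (r - 4) + 4 * (r - 2).
  by move/rootP: rp; rewrite pE; lra.
have rq : r <= q.
  apply: le_trans hq; apply/le_q_index/K11n2_plus_eigenvalue => //.
    by apply: leq_trans n7.
  by rewrite /N in r1; lra.
rewrite -/N; split; [rewrite /N in r1; lra | rewrite -/N; lra |].
have r4 : 0 < r - 4 by rewrite /N in r1 *; lra.
have rE : (r - N) * (r - 2) = 2 * (N - 2) + 8 / (r - 4).
  by apply: (mulIf (lt0r_neq0 r4)); rewrite rp [RHS]mulrDl divfK ?gt_eqF //; ring.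
(* Passing from r to q >= r lowers 8 / (q - 4) and raises the product. *)
apply: le_trans (_ : (r - N) * (r - 2) <= _).
  rewrite rE lerD2l ler_pM2l // lef_pV2 ?posrE //; first by lra.
  by apply: lt_le_trans r4 _; lra.
by apply: ler_pM; rewrite /N in r1 *; lra.
Qed.

Lemma K1_join_large q : q_index R (@K1_join_K4_K1 6) <= q -> 827 / 100 <= q.
Proof.
move=> hq.
pose p : {poly R} := ('X - 5%:P) * ('X - 7%:P) * ('X - 1%:P)
  - 4%:P * ('X - 1%:P) - ('X - 7%:P).
have pE x : p.[x] = (x - 5) * (x - 7) * (x - 1) - 4 * (x - 1) - (x - 7).
  by rewrite /p !hornerE.
(* The root located here is about 8.274. *)
have ab : 827 / 100 <= 9 :> R by lra.
have sign : p.[827 / 100] <= 0 <= p.[9].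
  by rewrite !pE; apply/andP; split; lra.
have [r /andP [r1 r2] rp] := poly_ivt ab sign.
have r7 : 7 < r by lra.
have {}rp : (r - 5) * (r - 7) * (r - 1) = 4 * (r - 1) + (r - 7).
  by move/rootP: rp; rewrite pE; lra.
by apply: le_trans r1 _; apply: le_trans hq; apply/le_q_index/K1_join_eigenvalue.
Qed.

End ExtremalEigenvalues.

Lemma large_q_index_heavy (R : realType) n (e : rel 'I_n) :
  simple_graph e -> no_isolated e -> 0 < q_index R e ->
  exists u v y, heavy_edge e (q_index R e) y u v.
Proof.
case=> e_sym e_irr noiso q0.
have [y ysub] := eigenvalue_subsolution e_sym q0 (q_index_attained q0).
exact: exists_heavy_edge noiso ysub.
Qed.

Unset Implicit Arguments.

Theorem theorem1p1 (R : realType) (n : nat) (e : rel 'I_n) :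
  simple_graph e -> no_isolated e -> (6 <= n)%N ->
  (n = 6%N ->
     q_index R (@K1_join_K4_K1 n) <= q_index R e ->
     ~ isomorphic e (@K1_join_K4_K1 n) ->
     has_trebly_chorded_cycle_at_vertex e) /\
  ((7 <= n)%N ->
     q_index R (@K11n2_plus n) <= q_index R e ->
     ~ isomorphic e (@K11n2_plus n) ->
     has_trebly_chorded_cycle_at_vertex e).
Proof.
move=> e_simple noiso n6; have [e_sym e_irr] := e_simple.
split=> [nE|n7] hq noniso; apply: contrapT => e_free; apply: noniso.
  subst n; have q8 := K1_join_large hq.
  have q0 : 0 < q_index R e by apply: lt_le_trans q8; lra.
  have [u [v [y uv_heavy]]] := large_q_index_heavy e_simple noiso q0.
  exact: (heavy_six e_sym e_irr e_free q8 uv_heavy).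
have q_large := K11n2_plus_large n7 hq.
have q0 : 0 < q_index R e by case: q_large => q8 _ _; apply: lt_le_trans q8; lra.
have [u [v [y uv_heavy]]] := large_q_index_heavy e_simple noiso q0.
exact: (heavy_seven e_sym e_irr e_free q_large uv_heavy n7).
Qed.
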